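(* Let $\eta$ be the real root of the polynomial $X^3+X^2+X-2$ and $\alpha=\log 2/\log(2/\eta)$. Let $G_{012}$ be the first Grigorchuk group with generating set $\{a,b,c,d\}$, acting on $X$, the orbit of $x_0=1^\infty$. For any finite group $A$ with $\#A\ge 3$ and symmetric generating set $S_A$ not containing the identity, there exists a spherically symmetric tree $\mathcal{T}$ inside the Cayley graph of $W=A\wr_XG_{012}$ with respect to $S_A\cup\{a,b,c,d\}$ (a subgraph which is a tree, rooted at the identity) that satisfies $$\mathrm{IBN}(\mathcal{T})=\underline{\mathrm{I}}_{gr}(W)=\alpha.$$
   Context: First Grigorchuk group: $G_{012}$ is the group of automorphisms of the rooted binary tree (vertices: finite words over $\{0,1\}$), acting on infinite words $\{0,1\}^\infty$ from the right, generated by $a,b,c,d$ defined recursively: $a$ exchanges the first letter ($0w\leftrightarrow1w$); $b$ maps $0w\mapsto0\,a(w)$, $1w\mapsto1\,c(w)$; $c$ maps $0w\mapsto0\,a(w)$, $1w\mapsto1\,d(w)$; $d$ maps $0w\mapsto0w$, $1w\mapsto1\,b(w)$. Here $x_0=1^\infty=111\cdots$ and $X=x_0G_{012}$ is its orbit in $\{0,1\}^\infty$. Permutation wreath product: for a group $G$ acting on $X$ from the right and a group $A$, $\sum_XA$ is the group of finitely supported functions $f:X\to A$, and $W=A\wr_XG$ is the semidirect product whose elements are written $fg$ ($f\in\sum_XA$, $g\in G$) with $$(f_1g_1)\cdot(f_2g_2)=(g_2^{-1}\cdot f_1)\,f_2\,g_1g_2,\qquad (g^{-1}\cdot f)(x)=f(xg^{-1}).$$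 An element $s\in A$ is identified with the function equal to $s$ at $x_0$ and to $1_A$ elsewhere. The Cayley graph joins $u$ to $us$ for each generator $s$. $\underline{\mathrm{I}}_{gr}(W)=\liminf_{n\to\infty}\log\log\#E_n/\log n$, where $E_n$ is the set of vertices at distance exactly $n$ from the identity in the Cayley graph. A rooted tree is spherically symmetric if all vertices at the same distance from the root have the same number of children. Trees are locally finite, infinite and rooted. For a rooted tree $\mathcal{T}=(V,E,\varrho)$, $|v|$ is the graph distance in $\mathcal{T}$ from $v$ to the root; for an edge $e$ with endpoints $e^-,e^+$ where $|e^+|=|e^-|+1$, put $|e|=|e^+|$. A cutset is a set $\pi\subset E$ such that every infinite self-avoiding path from $\varrho$ to infinity has exactly one edge in $\pi$; $\Pi$ is the set of all cutsets. The intermediate branching number is $$\mathrm{IBN}(\mathcal{T})=\sup\Big\{\lambda>0:\ \inf_{\pi\in\Pi}\sum_{e\in\pi}\exp(-|e|^{\lambda})>0\Big\},$$ with $\sup\emptyset=0$. *)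

(* Defs.v *)
From HB Require Import structures.
From mathcomp Require Import all_boot all_order all_algebra all_fingroup.
From mathcomp Require Import finmap.
From mathcomp Require Import all_classical all_reals all_analysis.

Set Implicit Arguments.
Unset Strict Implicit.
Unset Printing Implicit Defensive.

Import Order.TTheory GRing.Theory Num.Theory.

Local Open Scope classical_set_scope.

(* The vertices are the finite words; [false] stands for the letter 0 and
   [true] for the letter 1.  The inverse is carried along as data, but it is
   determined by [taut_fun] (see [taut_eqP]). *)
Record taut := Taut {
  taut_fun :> seq bool -> seq bool;
  taut_inv : seq bool -> seq bool;
  taut_funK : cancel taut_fun taut_inv;
  taut_invK : cancel taut_inv taut_fun;
  taut_size : forall w, size (taut_fun w) = size w;
  taut_prefix : forall u v, prefix u v -> prefix (taut_fun u) (taut_fun v)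
}.

HB.instance Definition _ := gen_eqMixin taut.
HB.instance Definition _ := gen_choiceMixin taut.

Lemma taut_eqP (g h : taut) : (forall w, g w = h w) -> g = h.
Proof.
case: g h => [f fi fK fiK fs fp] [g gi gK giK gs gp] /= fg.
have {fg} ? : f = g by apply: funext.
subst g.
have ? : fi = gi by apply: funext => w; rewrite -{1}(giK w) fK.
by subst gi; congr Taut; exact: Prop_irrelevance.
Qed.

Lemma taut_take (g : taut) n w : g (take n w) = take n (g w).
Proof.
have [wn|nw] := leqP (size w) n; first by rewrite !take_oversize ?taut_size.
have : prefix (g (take n w)) (g w) by apply: taut_prefix; exact: prefix_take.
rewrite prefixE => /eqP <-.
by rewrite taut_size size_takel// ltnW.
Qed.

Fact taut_inv_size (g : taut) w : size (taut_inv g w) = size w.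
Proof. by rewrite -(taut_size g) taut_invK. Qed.

Fact taut_inv_prefix (g : taut) u v :
  prefix u v -> prefix (taut_inv g u) (taut_inv g v).
Proof.
rewrite prefixE => /eqP uv; rewrite -{1}uv -{1}(taut_invK g v) -taut_take.
by rewrite taut_funK prefix_take.
Qed.

Definition taut_one : taut :=
  @Taut id id (fun=> erefl) (fun=> erefl) (fun=> erefl) (fun _ _ p => p).

Definition taut_invg (g : taut) : taut :=
  Taut (@taut_invK g) (@taut_funK g) (@taut_inv_size g) (@taut_inv_prefix g).

(* Automorphisms act from the right: [g * h] is [g] followed by [h]. *)
Program Definition taut_mul (g h : taut) : taut :=
  @Taut (h \o g) (taut_inv g \o taut_inv h) _ _ _ _.
Next Obligation. by move=> g h w /=; rewrite !taut_funK. Qed.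
Next Obligation. by move=> g h w /=; rewrite !taut_invK. Qed.
Next Obligation. by move=> g h w /=; rewrite !taut_size. Qed.
Next Obligation. by move=> g h u v uv /=; do 2 apply: taut_prefix. Qed.

Fact taut_mulA : associative taut_mul.
Proof. by move=> f g h; exact: taut_eqP. Qed.
Fact taut_mul1 : left_id taut_one taut_mul.
Proof. by move=> g; exact: taut_eqP. Qed.
Fact taut_mulr1 : right_id taut_one taut_mul.
Proof. by move=> g; exact: taut_eqP. Qed.
Fact taut_mulV : left_inverse taut_one taut_invg taut_mul.
Proof. by move=> g; apply: taut_eqP => w /=; rewrite taut_invK. Qed.
Fact taut_mulrV : right_inverse taut_one taut_invg taut_mul.
Proof. by move=> g; apply: taut_eqP => w /=; rewrite taut_funK. Qed.

HB.instance Definition _ := isGroup.Build taut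
  taut_mulA taut_mul1 taut_mulr1 taut_mulV taut_mulrV.

Definition grig_a (w : seq bool) : seq bool :=
  if w is x :: w' then ~~ x :: w' else [::].

Fixpoint grig_b (w : seq bool) : seq bool :=
  match w with
  | [::] => [::]
  | false :: w' => false :: grig_a w'
  | true :: w' => true :: grig_c w'
  end
with grig_c (w : seq bool) : seq bool :=
  match w with
  | [::] => [::]
  | false :: w' => false :: grig_a w'
  | true :: w' => true :: grig_d w'
  end
with grig_d (w : seq bool) : seq bool :=
  match w with
  | [::] => [::]
  | false :: w' => false :: w'
  | true :: w' => true :: grig_b w'
  end.

Fact grig_aK : involutive grig_a.
Proof. by case=> [|x w] //=; rewrite negbK. Qed.
Fact grig_a_size w : size (grig_a w) = size w.
Proof. by case: w. Qed.
Fact grig_a_prefix u v : prefix u v -> prefix (grig_a u) (grig_a v).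
Proof. by case: u v => [|x u] [|y v] //= /andP[/eqP-> ->]; rewrite eqxx. Qed.

Fact grig_bcdK w :
  [/\ grig_b (grig_b w) = w, grig_c (grig_c w) = w & grig_d (grig_d w) = w].
Proof. by elim: w => [|[] w [hb hc hd]] //=; rewrite ?hb ?hc ?hd ?grig_aK. Qed.
Fact grig_bcd_size w :
  [/\ size (grig_b w) = size w, size (grig_c w) = size w
    & size (grig_d w) = size w].
Proof.
by elim: w => [|[] w [hb hc hd]] //=; rewrite ?hb ?hc ?hd ?grig_a_size.
Qed.
Fact grig_bcd_prefix u v : prefix u v ->
  [/\ prefix (grig_b u) (grig_b v), prefix (grig_c u) (grig_c v)
    & prefix (grig_d u) (grig_d v)].
Proof.
elim: u v => [|[] u IHu] [|[] v] //= uv; last by rewrite grig_a_prefix.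
by case: (IHu _ uv).
Qed.

Fact grig_bK : involutive grig_b. Proof. by move=> w; case: (grig_bcdK w). Qed.
Fact grig_cK : involutive grig_c. Proof. by move=> w; case: (grig_bcdK w). Qed.
Fact grig_dK : involutive grig_d. Proof. by move=> w; case: (grig_bcdK w). Qed.
Fact grig_b_size w : size (grig_b w) = size w.
Proof. by case: (grig_bcd_size w). Qed.
Fact grig_c_size w : size (grig_c w) = size w.
Proof. by case: (grig_bcd_size w). Qed.
Fact grig_d_size w : size (grig_d w) = size w.
Proof. by case: (grig_bcd_size w). Qed.
Fact grig_b_prefix u v : prefix u v -> prefix (grig_b u) (grig_b v).
Proof. by case/grig_bcd_prefix. Qed.
Fact grig_c_prefix u v : prefix u v -> prefix (grig_c u) (grig_c v).
Proof. by case/grig_bcd_prefix. Qed.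
Fact grig_d_prefix u v : prefix u v -> prefix (grig_d u) (grig_d v).
Proof. by case/grig_bcd_prefix. Qed.

Definition taut_a : taut := Taut grig_aK grig_aK grig_a_size grig_a_prefix.
Definition taut_b : taut := Taut grig_bK grig_bK grig_b_size grig_b_prefix.
Definition taut_c : taut := Taut grig_cK grig_cK grig_c_size grig_c_prefix.
Definition taut_d : taut := Taut grig_dK grig_dK grig_d_size grig_d_prefix.

Definition subgroup_gen (G : groupType) (S : set G) : set G :=
  \bigcap_(H in [set H : set G | group_closed (mem H) /\ S `<=` H]) H.

Fact subgroup_gen_closed (G : groupType) (S : set G) :
  group_closed (mem (subgroup_gen S)).
Proof.
split=> [|x y]; first by apply/mem_set => H [[H1 _] _]; exact: set_mem H1.
move=> /set_mem Sx /set_mem Sy; apply/mem_set => H HS; have [[_ Hd] _] := HS.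
by apply: set_mem; apply: Hd; apply/mem_set; [exact: Sx|exact: Sy].
Qed.

Lemma sub_subgroup_gen (G : groupType) (S : set G) : S `<=` subgroup_gen S.
Proof. by move=> x Sx H [_]; exact. Qed.

Definition grig_gens : set taut :=
  [set g | [\/ g = taut_a, g = taut_b, g = taut_c | g = taut_d]].

Definition grigorchuk : Type := set_type (subgroup_gen grig_gens).

HB.instance Definition _ := SubType.on grigorchuk.
HB.instance Definition _ := Choice.on grigorchuk.
HB.instance Definition _ := SubChoice_isSubGroup.Build taut
  (fun g => g \in subgroup_gen grig_gens) grigorchuk
  (subgroup_gen_closed grig_gens).

Definition grigorchuk_gens : set grigorchuk := [set g | grig_gens (val g)].

Record right_action (G : groupType) (X : Type) := RightAction {
  ract :> X -> G -> X;
  ract1 : forall x, ract x 1%g = x;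
  ractM : forall x g h, ract x (g * h)%g = ract (ract x g) h
}.

Record wreath (A G : groupType) (X : Type) (to : right_action G X) := Wreath {
  wr_fun : X -> A;
  wr_top : G;
  wr_finite : finite_set [set x | wr_fun x <> 1%g]
}.

HB.instance Definition _ (A G : groupType) (X : Type) (to : right_action G X) :=
  gen_eqMixin (wreath A to).
HB.instance Definition _ (A G : groupType) (X : Type) (to : right_action G X) :=
  gen_choiceMixin (wreath A to).

Section WreathGroup.
Variables (A G : groupType) (X : Type) (to : right_action G X).
Implicit Types u v w : wreath A to.

Lemma wreath_eqP u v :
  (forall x, wr_fun u x = wr_fun v x) -> wr_top u = wr_top v -> u = v.
Proof.
case: u v => [f g fP] [f' g' fP'] /= ff' gg'.
have ? : f = f' by apply: funext.
by subst f' g'; congr Wreath; exact: Prop_irrelevance.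
Qed.

Fact ractK (g : G) : cancel (to^~ g) (to^~ (g^-1)%g).
Proof. by move=> x /=; rewrite -ractM mulgV ract1. Qed.
Fact ractVK (g : G) : cancel (to^~ (g^-1)%g) (to^~ g).
Proof. by move=> x /=; rewrite -ractM mulVg ract1. Qed.

Fact finite_shift (P : set X) (g : G) :
  finite_set P -> finite_set [set x | P (to x g)].
Proof.
move=> finP; apply: (sub_finite_set _ (finite_image (to^~ (g^-1)%g) finP)).
by move=> x Px; exists (to x g) => //; rewrite ractK.
Qed.

Fact wr_one_finite : finite_set [set x : X | (1 : A)%g <> 1%g].
Proof. by apply: sub_finite_set (finite_set0 X) => x /=. Qed.

Definition wr_one : wreath A to := Wreath to 1%g wr_one_finite.

Fact wr_mul_finite u v :
  finite_set [set x | (wr_fun u (to x (wr_top v)^-1) * wr_fun v x)%g <> 1%g].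
Proof.
have finU : finite_set
    ([set x | wr_fun u (to x (wr_top v)^-1)%g <> 1%g]
     `|` [set x | wr_fun v x <> 1%g]).
  rewrite finite_setU; split; last exact: wr_finite.
  exact: (finite_shift _ (wr_finite u)).
apply: (sub_finite_set _ finU) => x /= uvx.
apply: contrapT => /not_orP[/contrapT ux /contrapT vx].
by apply: uvx; rewrite ux vx mulg1.
Qed.

(* (f1 g1)(f2 g2) = (g2^-1 . f1) f2 g1 g2, where (g^-1 . f)(x) = f (x g^-1) *)
Definition wr_mul u v : wreath A to :=
  Wreath to (wr_top u * wr_top v)%g (@wr_mul_finite u v).

Fact wr_inv_finite u :
  finite_set [set x | ((wr_fun u (to x (wr_top u)))^-1)%g <> 1%g].
Proof.
apply: (sub_finite_set _ (finite_shift (wr_top u) (wr_finite u))) => x /= ux.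
by move=> ux1; apply: ux; rewrite ux1 invg1.
Qed.

Definition wr_inv u : wreath A to :=
  Wreath to (wr_top u)^-1%g (@wr_inv_finite u).

Fact wr_mulA : associative wr_mul.
Proof.
move=> u v w; apply: wreath_eqP => [x|] /=; last by rewrite mulgA.
by rewrite invMg ractM mulgA.
Qed.
Fact wr_mul1 : left_id wr_one wr_mul.
Proof. by move=> u; apply: wreath_eqP => [x|] /=; rewrite mul1g. Qed.
Fact wr_mulr1 : right_id wr_one wr_mul.
Proof.
by move=> u; apply: wreath_eqP => [x|] /=; rewrite mulg1// invg1 ract1.
Qed.
Fact wr_mulV : left_inverse wr_one wr_inv wr_mul.
Proof.
by move=> u; apply: wreath_eqP => [x|] /=; rewrite ?ractVK mulVg.
Qed.
Fact wr_mulrV : right_inverse wr_one wr_inv wr_mul.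
Proof.
by move=> u; apply: wreath_eqP => [x|] /=; rewrite ?invgK mulgV.
Qed.

HB.instance Definition _ := isGroup.Build (wreath A to)
  wr_mulA wr_mul1 wr_mulr1 wr_mulV wr_mulrV.

End WreathGroup.

Section WreathInjections.
Variables (A G : groupType) (X : eqType) (to : right_action G X).

Fact wr_base_finite (x0 : X) (s : A) :
  finite_set [set x | (if x == x0 then s else 1%g) <> 1%g].
Proof.
by apply: sub_finite_set (finite_set1 x0) => x /=; case: eqP.
Qed.

Definition wr_base (x0 : X) (s : A) : wreath A to :=
  Wreath to 1%g (@wr_base_finite x0 s).

Definition wr_lift (g : G) : wreath A to := Wreath to g (wr_one_finite A X).

End WreathInjections.

(* The action of tree automorphisms extended to infinite words. *)
Definition taut_act (xi : nat -> bool) (g : taut) : nat -> bool :=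
  fun n => nth false (g (mkseq xi n.+1)) n.

Lemma mkseq_taut_act xi (g : taut) n : mkseq (taut_act xi g) n = g (mkseq xi n).
Proof.
apply: (@eq_from_nth _ false) => [|i]; rewrite ?taut_size !size_mkseq// => ltin.
rewrite nth_mkseq// /taut_act.
have -> : mkseq xi i.+1 = take i.+1 (mkseq xi n).
  by rewrite /mkseq -map_take take_iota; move/minn_idPl: ltin => ->.
by rewrite taut_take nth_take.
Qed.

Fact taut_act1 xi : taut_act xi 1%g = xi.
Proof. by apply: funext => n; rewrite /taut_act /= nth_mkseq. Qed.
Fact taut_actM xi (g h : taut) :
  taut_act xi (g * h)%g = taut_act (taut_act xi g) h.
Proof. by apply: funext => n; rewrite /taut_act [in RHS]mkseq_taut_act. Qed.

Definition all_ones : nat -> bool := fun=> true.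

Definition ones_orbit : set (nat -> bool) :=
  [set taut_act all_ones (val g) | g in [set: grigorchuk]].

Definition orbX : Type := set_type ones_orbit.
HB.instance Definition _ := Choice.on orbX.
HB.instance Definition _ := SubType.on orbX.

Fact ones_orbit0 : all_ones \in ones_orbit.
Proof. by apply/mem_set; exists 1%g => //; rewrite taut_act1. Qed.

Definition orb0 : orbX := exist _ all_ones ones_orbit0.

Fact orb_act_subproof (x : orbX) (g : grigorchuk) :
  taut_act (val x) (val g) \in ones_orbit.
Proof.
have /set_mem[h _ <-] := valP x.
by apply/mem_set; exists (h * g)%g => //; rewrite -taut_actM.
Qed.

Definition orb_act (x : orbX) (g : grigorchuk) : orbX :=
  exist _ (taut_act (val x) (val g)) (orb_act_subproof x g).

Fact orb_act1 x : orb_act x 1%g = x.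
Proof. by apply: val_inj; rewrite /= taut_act1. Qed.
Fact orb_actM x g h : orb_act x (g * h)%g = orb_act (orb_act x g) h.
Proof. by apply: val_inj; rewrite /= -taut_actM. Qed.

Definition orb_action : right_action grigorchuk orbX :=
  RightAction orb_act1 orb_actM.

Definition grig_wreath (A : groupType) : groupType := wreath A orb_action.

Definition grig_wreath_gens (A : finGroupType) (SA : {set A}) :
    set (grig_wreath A) :=
  [set wr_base orb_action orb0 s | s in [set s | s \in SA]]
  `|` [set wr_lift A orb_action g | g in grigorchuk_gens].

Definition cayley (W : groupType) (S : set W) : rel W :=
  fun u v => `[< exists2 s, S s & v = (u * s)%g >].

Section Distance.
Variables (T : choiceType) (E : rel T).

Definition walk_of_length (x y : T) (n : nat) : Prop :=
  exists p : seq T, [/\ path E x p, last x p = y & size p = n].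

Definition dist_is (x y : T) (n : nat) : Prop :=
  walk_of_length x y n /\ forall m, walk_of_length x y m -> (n <= m)%N.

(* An unspecified value when [x] and [y] are not connected. *)
Definition gdist (x y : T) : nat := get (dist_is x y).

Definition sphere (x : T) (n : nat) : set T := [set y | dist_is x y n].

End Distance.

Section IntermediateGrowth.
Variable R : realType.
Local Open Scope ring_scope.

Definition lower_growth_exponent (W : groupType) (S : set W) : \bar R :=
  limn_einf (fun n : nat =>
    (ln (ln (#|` fset_set (sphere (cayley S) 1%g n)|%:R : R)) / ln n%:R)%:E).

End IntermediateGrowth.

Record rooted_tree (T : choiceType) := RootedTree {
  tree_vert : set T;
  tree_adj : rel T;
  tree_root : T;
  tree_rootP : tree_vert tree_root;
  tree_adj_vert : forall u v, tree_adj u v -> tree_vert u /\ tree_vert v;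
  tree_sym : symmetric tree_adj;
  tree_irr : irreflexive tree_adj;
  tree_connected : forall v, tree_vert v ->
    exists p, path tree_adj tree_root p /\ last tree_root p = v;
  tree_acyclic : forall c : seq T, (2 < size c)%N -> ~ ucycle tree_adj c;
  tree_locally_finite : forall u, finite_set [set v | tree_adj u v];
  tree_infinite : infinite_set tree_vert
}.

Section RootedTree.
Variables (T : choiceType) (t : rooted_tree T).

Definition depth (v : T) : nat := gdist (tree_adj t) v (tree_root t).

Definition children (v : T) : set T :=
  [set w | tree_adj t v w /\ depth w = (depth v).+1].

Definition spherically_symmetric : Prop :=
  forall u v, tree_vert t u -> tree_vert t v -> depth u = depth v ->
    (children u #= children v)%card.

(* An edge is encoded as the pair (e^-, e^+) of its endpoints, the second one
   being farther from the root; in a tree each edge has exactly one such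
   orientation. *)
Definition tree_edge : set (T * T) := [set e | children e.1 e.2].

Definition ray (r : nat -> T) : Prop :=
  [/\ r 0%N = tree_root t, forall n, tree_adj t (r n) (r n.+1) & injective r].

(* A self-avoiding path from the root of a tree only goes away from the root,
   hence crosses its edges in the orientation of [tree_edge]. *)
Definition ray_edges (r : nat -> T) : set (T * T) :=
  [set (r n, r n.+1) | n in [set: nat]].

Definition cutset (p : set (T * T)) : Prop :=
  p `<=` tree_edge /\
  forall r, ray r -> exists! e, p e /\ ray_edges r e.

Section IBN.
Variable R : realType.
Local Open Scope ring_scope.
Local Open Scope ereal_scope.

Definition cutset_inf (lambda : R) : \bar R :=
  ereal_inf [set \esum_(e in p)
                   (expR (- ((depth e.2)%:R `^ lambda))%R)%:E | p in cutset].

(* Adding 0 to a set of positive numbers changes its supremum only when the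
   set is empty: this is the convention sup set0 = 0. *)
Definition IBN : \bar R :=
  ereal_sup (0 |` [set lambda%:E | lambda in
                    [set l : R | (0 < l)%R /\ 0 < cutset_inf l]]).

End IBN.
End RootedTree.

Definition rooted_subtree_of (T : choiceType) (t : rooted_tree T)
    (E : rel T) (x : T) : Prop :=
  tree_root t = x /\ subrel (tree_adj t) E.

(* Main.v *)
Require Import Defs.
From mathcomp Require Import all_boot all_order all_algebra all_fingroup.
From mathcomp Require Import finmap zify ring lra cyclic.
From mathcomp Require Import all_classical all_reals all_analysis.

(** Both exponents are squeezed between bounds of the form [exp (c n^alpha)],
    where [(2 / eta)^alpha = 2]: lengths are scaled by [2 / eta] each time that
    the exponent of the count doubles.

    Upper bound.  The letter 1 in front of [x0 = 1 x0] makes [W] self-similar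
    like the Grigorchuk group: an element is determined by its action on the
    first letter and by two sections in [W], with [a = swap], [b = (a, c)],
    [c = (a, d)], [d = (1, b)] and [s = (1, s)] for a lamp generator [s].  The
    lamp generators commute with [b, c, d], so that elements are words
    [k0 a k1 a ... km].  For Bartholdi's weights, [|a| = 1 - eta^3],
    [|b| = eta^3], [|c| = 1 - eta^2], [|d| = 1 - eta] and weight 0 for the
    lamps, the total weight of the two sections is at most [eta] times the
    weight of the word, up to a constant ([section_weight]).  After [k] levels,
    an element of length [(2 / eta)^k] is described by [2^k] words of total
    length of the order of [2^k], hence by so many symbols of a finite alphabet
    ([encodes_size], [ball_card_le]).

    Lower bound.  The substitution [ab -> abadac], [ac -> abab], [ad -> acac]
    inverts this contraction: both sections of the image of a word are the word
    itself, up to [a] at the ends ([act_subst]).  It multiplies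
    lengths by [2 / eta] asymptotically and at least doubles the number of
    points of the orbit of [x0] which the word visits ([visited_subst]).  Its
    infinite fixed point thus visits at least [c n^alpha] points during its
    first [n] letters, for some [c > 0].

    The tree.  Follow that infinite word and, at each first visit of a point,
    multiply by one of two distinct elements [s1], [s2] of [SA]; they exist as
    [A] has at least three elements.  Each choice lights a lamp at a new point,
    so that different choices give different elements, and loops of the word
    between two lamps are erased ([lamp_path]), so that the tree embeds
    ([lamp_label_inj]).  It is spherically symmetric, and level [n] has
    [2^m] vertices, where [m + 1 >= c n^alpha].

    Conclusion.  An even flow from the root shows that the cutset sums with
    exponent [l < alpha] are bounded below ([cutset_inf_ge]), while the level
    cutsets, whose size is bounded by that of the balls of [W], give the
    converse ([cutset_inf_le]).  As for the growth of [W], the tree bounds the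
    balls from below.  The bound passes to spheres because
    each element of the ball of radius [(K+1) n] is a product of at most [K]
    elements of the sphere of radius [n] and an element of the ball of radius
    [n] ([card_ball_mul]), which is much smaller than the former ball when [K]
    is large ([sphere_powR]). *)

Set Implicit Arguments.
Unset Strict Implicit.
Unset Printing Implicit Defensive.
Import Order.TTheory GRing.Theory Num.Theory.
Import numFieldNormedType.Exports.
Local Open Scope classical_set_scope.

(** * Trees coded by binary sequences *)

Section Esum.
Local Open Scope ring_scope.

Lemma esum_le_subset (R : realType) (I : choiceType) (A B : set I) (f : I -> \bar R) :
  B `<=` A -> (forall i, 0 <= f i)%E ->
  (\esum_(i in B) f i <= \esum_(i in A) f i)%E.
Proof.
move=> BA f0; rewrite (esumID B A)//.
by rewrite (_ : A `&` B = B) ?leeDl ?esum_ge0//; apply/setIidr.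
Qed.

Lemma esum_le_card (R : realType) (I J : choiceType) (A : set I) (B : set J) (g : I -> J)
    (f : I -> \bar R) (m : R) :
    finite_set B -> {in A &, injective g} -> (forall i, A i -> B (g i)) ->
    (forall i, A i -> f i = m%:E) -> 0 <= m ->
  (\esum_(i in A) f i <= (m *+ #|` fset_set B|)%:E)%E.
Proof.
move=> finB ginj gAB fm m0; have finA : finite_set A.
  rewrite -(eq_finite_set (inj_card_eq ginj)).
  by apply: sub_finite_set finB => _ [i Ai <-]; exact: gAB.
rewrite esum_fset//; last by move=> i /set_mem/fm->; rewrite lee_fin.
rewrite fsbig_finite//=.
rewrite (eq_big_seq (fun=> m%:E)); last first.
  by move=> i; rewrite in_fset_set// => /set_mem/fm.
rewrite sumEFin lee_fin big_const_seq count_predT iter_addr_0.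
apply: ler_wpMn2l => //.
have ginj' : {in fset_set A &, injective g}.
  by move=> i j; rewrite !in_fset_set//; exact: ginj.
rewrite -(card_in_imfset imfset_key ginj'); apply: fsubset_leq_card.
apply/fsubsetP => _ /imfsetP[i iA ->]; rewrite in_fset_set//; apply/mem_set.
by apply: gAB; apply: set_mem; rewrite -in_fset_set.
Qed.

End Esum.

Section CodedTree.
Variables (T : choiceType) (br : nat -> bool) (label : seq bool -> T).

(** A vertex at depth [n] is coded by a sequence of [n] bits.  At the depths
    [n] without [br n] the bit is forced, and the tree does not branch. *)
Definition admissible (d : seq bool) : bool :=
  all (fun i => nth false d i ==> br i) (iota 0 (size d)).

Lemma admissible_rcons d b :
  admissible (rcons d b) = admissible d && (b ==> br (size d)).
Proof.
rewrite /admissible size_rcons -addn1 iotaD all_cat /= andbT add0n.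
rewrite nth_rcons ltnn eqxx; congr andb; apply: eq_in_all => i.
by rewrite mem_iota add0n /= nth_rcons => ->.
Qed.

Hypothesis label_inj : forall d d', admissible d -> admissible d' ->
  label d = label d' -> d = d'.

Definition decode (u : T) : seq bool :=
  xget [::] [set d | admissible d /\ label d = u].

Lemma labelK d : admissible d -> decode (label d) = d.
Proof.
move=> ad; rewrite /decode; case: xgetP => [d' _ [ad' /label_inj->]//|/(_ d)[]].
by split.
Qed.

Definition coded_vert : set T := [set u | exists2 d, admissible d & label d = u].

Definition coded_child : rel T := fun u v =>
  `[< exists d b, [/\ admissible (rcons d b), u = label d
                    & v = label (rcons d b)] >].

Definition coded_adj : rel T := fun u v => coded_child u v || coded_child v u.

Lemma coded_child_label d v : admissible d -> coded_child (label d) v ->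
  exists2 b, admissible (rcons d b) & v = label (rcons d b).
Proof.
move=> ad /asboolP[d' [b [adb /label_inj dd' ->]]]; exists b; last first.
  by rewrite dd'//; move: adb; rewrite admissible_rcons => /andP[].
by rewrite dd'//; move: adb; rewrite admissible_rcons => /andP[].
Qed.

Lemma coded_child_rcons d b : admissible (rcons d b) ->
  coded_child (label d) (label (rcons d b)).
Proof. by move=> adb; apply/asboolP; exists d, b. Qed.

Lemma coded_child_vert u v : coded_child u v -> coded_vert u /\ coded_vert v.
Proof.
move=> /asboolP[d [b [adb -> ->]]]; split; last by exists (rcons d b).
by exists d => //; move: adb; rewrite admissible_rcons => /andP[].
Qed.

Lemma coded_child_size u v : coded_child u v ->
  size (decode v) = (size (decode u)).+1.
Proof.
move=> /asboolP[d [b [adb -> ->]]].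
rewrite !labelK ?size_rcons//.
by move: adb; rewrite admissible_rcons => /andP[].
Qed.

Lemma coded_parent_uniq u u' v : coded_child u v -> coded_child u' v -> u = u'.
Proof.
move=> /asboolP[d [b [adb -> ->]]] /asboolP[d' [b' [adb' ->]]].
by move=> /label_inj-/(_ adb adb')/rcons_inj[->].
Qed.

Lemma coded_adj_vert u v : coded_adj u v -> coded_vert u /\ coded_vert v.
Proof. by case/orP=> /coded_child_vert []. Qed.

Lemma coded_adj_sym : symmetric coded_adj.
Proof. by move=> u v; rewrite /coded_adj orbC. Qed.

Lemma coded_adj_irr : irreflexive coded_adj.
Proof.
by move=> u; apply/negP; case/orP=> /coded_child_size /eqP;
  rewrite -[eqbLHS]addn0 -addn1 eqn_add2l.
Qed.

Lemma coded_connected v : coded_vert v ->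
  exists p, path coded_adj (label [::]) p /\ last (label [::]) p = v.
Proof.
move=> [d ad <-]; elim/last_ind: d ad => [|d b IH] ad; first by exists [::].
have [|p [pp lp]] := IH; first by move: ad; rewrite admissible_rcons => /andP[].
exists (rcons p (label (rcons d b))); rewrite rcons_path last_rcons pp lp.
by rewrite /coded_adj coded_child_rcons.
Qed.

(** A vertex of maximal depth on a cycle would have both of its neighbours as
    parents. *)
Lemma coded_acyclic (c : seq T) : (2 < size c)%N -> ~ ucycle coded_adj c.
Proof.
move=> c2 /andP[cc uc].
have [x xc xmax] : exists2 x, x \in c &
    {in c, forall y, (size (decode y) <= size (decode x))%N}.
  have : c != [::] by case: (c) c2.
  elim: (c) => // x s IH _; have [->|/IH[y ys ymax]] := eqVneq s [::].
    by exists x => [|y]; rewrite mem_seq1// => /eqP->.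
  have [xy|/ltnW yx] := leqP (size (decode x)) (size (decode y)).
    by exists y => [|z]; rewrite inE ?ys ?orbT// => /orP[/eqP->|/ymax].
  exists x => [|z]; rewrite inE ?eqxx// => /orP[/eqP->//|/ymax zy].
  exact: leq_trans zy yx.
have [i s cE] := rot_to xc.
have {cc} : path.cycle coded_adj (x :: s) by rewrite -cE rot_cycle.
have {uc} : uniq (x :: s) by rewrite -cE rot_uniq.
have {c2} : (2 < size (x :: s))%N by rewrite -cE size_rot.
have {xc}xmax y : y \in x :: s -> (size (decode y) <= size (decode x))%N.
  by rewrite -cE mem_rot; exact: xmax.
case: s {cE} xmax => // y s xmax; rewrite /= rcons_path => s2 u.
move=> /andP[xy /andP[_ zx]]; move: s2 u; case/lastP: s xmax zx => // s z.
rewrite last_rcons => xmax zx _ /andP[_ /andP[+ _]].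
have par t : t \in x :: y :: rcons s z -> coded_adj x t -> coded_child t x.
  move=> /xmax tx /orP[/coded_child_size tE|//].
  by move: tx; rewrite tE ltnn.
rewrite mem_rcons inE negb_or => /andP[/eqP + _]; apply.
apply: (@coded_parent_uniq _ _ x); apply: par => //.
- by rewrite !inE eqxx orbT.
- by rewrite !inE mem_rcons inE eqxx !orbT.
- by rewrite coded_adj_sym.
Qed.

Lemma coded_locally_finite u : finite_set [set v | coded_adj u v].
Proof.
apply: (@sub_finite_set _ _ ([set label (take (size (decode u)).-1 (decode u))]
  `|` [set label (rcons (decode u) b) | b in [set: bool]])); last first.
  by rewrite finite_setU; split; [exact: finite_set1|exact: finite_image].
move=> v /= /orP[/asboolP|/asboolP] [d [b [adb -> ->]]].
  right; exists b => //; rewrite labelK//.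
  by move: adb; rewrite admissible_rcons => /andP[].
by left; rewrite /= labelK// size_rcons -cats1 take_size_cat.
Qed.

Lemma admissible_nseq n : admissible (nseq n false).
Proof. by apply/allP => i _; rewrite nth_nseq if_same. Qed.

Lemma coded_infinite : infinite_set coded_vert.
Proof.
have linj : {in [set: nat] &, injective (fun n => label (nseq n false))}.
  move=> n m _ _ /(label_inj (admissible_nseq n) (admissible_nseq m)).
  by move=> /(congr1 size); rewrite !size_nseq.
move=> finV; apply: infinite_nat; rewrite -(eq_finite_set (inj_card_eq linj)).
apply: sub_finite_set finV => _ [n _ <-]; exists (nseq n false) => //.
exact: admissible_nseq.
Qed.

Lemma coded_root : coded_vert (label [::]).
Proof. by exists [::]. Qed.

Definition coded_tree : rooted_tree T :=
  RootedTree coded_root coded_adj_vert coded_adj_sym coded_adj_irr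
    coded_connected coded_acyclic coded_locally_finite coded_infinite.

Lemma depth_label d : admissible d -> depth coded_tree (label d) = size d.
Proof.
move=> ad; have dP : dist_is coded_adj (label d) (label [::]) (size d).
  split.
    elim/last_ind: d ad => [_|d b IH ad]; first by exists [::].
    have [|p [pp lp sp]] := IH.
      by move: ad; rewrite admissible_rcons => /andP[].
    exists (label d :: p); split => //=; last by rewrite size_rcons sp.
    by rewrite pp /coded_adj coded_child_rcons// orbT.
  move=> m [p [pp lp <-]].
  suff : (size (decode (label d)) <= size (decode (label [::])) + size p)%N.
    by rewrite !labelK.
  rewrite -{}lp; elim: p (label d) pp => [|y p IH] x /=; first by rewrite addn0.
  move=> /andP[xy /IH yp]; rewrite addnS.
  by case/orP: xy => /coded_child_size xy; lia.
have : dist_is coded_adj (label d) (label [::]) (depth coded_tree (label d)).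
  by rewrite /depth /gdist; exact: (getI dP).
case=> w minw; apply/eqP; rewrite eqn_leq; apply/andP; split.
  exact: minw (proj1 dP).
exact: (proj2 dP).
Qed.

Lemma children_label d : admissible d ->
  children coded_tree (label d) =
  [set label (rcons d b) | b in [set b | b ==> br (size d)]].
Proof.
move=> ad; apply/seteqP; split=> [v /= [dv dv']|_ [b /= bd <-]]; last first.
  have adb : admissible (rcons d b) by rewrite admissible_rcons ad.
  by split; [rewrite /= /coded_adj coded_child_rcons
            |rewrite !depth_label// size_rcons].
case/orP: dv => [/(coded_child_label ad)[b adb vE]|vd].
  by exists b => //; move: adb; rewrite admissible_rcons => /andP[].
have [[d' ad' vE] _] := coded_child_vert vd; move: vd dv'.
by rewrite -vE !depth_label// => /coded_child_size; rewrite !labelK//; lia.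
Qed.

Lemma coded_spherically_symmetric : spherically_symmetric coded_tree.
Proof.
move=> _ _ [d ad <-] [d' ad' <-]; rewrite !depth_label// !children_label//.
move=> dd'; have inj e : admissible e ->
    {in [set b | b ==> br (size e)] &, injective (fun b => label (rcons e b))}.
  move=> ae b b' /set_mem /= be /set_mem /= be' /label_inj.
  by rewrite !admissible_rcons ae => /(_ be be')/rcons_inj[].
apply: card_eq_trans (inj_card_eq (inj _ ad)) _.
by rewrite card_eq_sym dd'; exact: inj_card_eq (inj _ ad').
Qed.

Definition branchings n := count br (iota 0 n).

Lemma branchingsS n : branchings n.+1 = (branchings n + br n)%N.
Proof. by rewrite /branchings -addn1 iotaD count_cat /= addn0. Qed.

Lemma admissible_enum n : exists s : seq (seq bool),
  [/\ uniq s, size s = (2 ^ branchings n)%N &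
      forall d, d \in s -> admissible d /\ size d = n].
Proof.
elim: n => [|n [s [us ss sn]]].
  by exists [:: [::]]; split=> // d; rewrite mem_seq1 => /eqP->.
have rc (b : bool) : injective (fun d => rcons d b) by move=> d d' /rcons_inj[].
have [brn|brn] := boolP (br n); last first.
  exists (map (rcons^~ false) s); split; first by rewrite (map_inj_uniq (rc _)).
    by rewrite size_map branchingsS (negbTE brn) addn0.
  by move=> _ /mapP[d /sn[ad dn] ->]; rewrite admissible_rcons ad size_rcons dn.
exists (map (rcons^~ false) s ++ map (rcons^~ true) s); split.
- rewrite cat_uniq !(map_inj_uniq (rc _)) us andbT; apply/hasPn => _ /mapP[d _ ->].
  by apply/mapP => -[d' _ /rcons_inj[]].
- by rewrite size_cat !size_map branchingsS brn ss addn1 expnS mul2n addnn.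
- by move=> d; rewrite mem_cat => /orP[]/mapP[d' /sn[ad dn] ->];
    rewrite admissible_rcons size_rcons ad dn ?brn.
Qed.

Lemma card_level (B : set T) n :
    finite_set B -> (forall d, admissible d -> size d = n -> B (label d)) ->
  (2 ^ branchings n <= #|` fset_set B|)%N.
Proof.
move=> finB labB; have [s [us <- sn]] := admissible_enum n.
rewrite -(size_map label); apply: uniq_leq_size.
  rewrite map_inj_in_uniq// => d d' /sn[ad _] /sn[ad' _]; exact: label_inj.
move=> _ /mapP[d /sn[ad dn] ->]; rewrite in_fset_set//; apply/mem_set.
exact: labB.
Qed.

(** In a tree a self-avoiding path cannot turn back, since the only way
    towards the root is the edge it arrived through. *)
Lemma ray_label r : ray coded_tree r -> forall n,
  exists d b, [/\ size d = n, admissible (rcons d b), r n = label d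
                & r n.+1 = label (rcons d b)].
Proof.
move=> [r0 radj rinj]; elim=> [|n [d [b [dn adb rn rSn]]]].
  have : coded_adj (r 0%N) (r 1%N) := radj 0%N; rewrite r0 /=.
  case/orP=> [/(coded_child_label (d := [::]) isT)[b adb ->]|].
    by exists [::], b.
  by move/coded_child_size; rewrite labelK.
exists (rcons d b); rewrite size_rcons dn.
have : coded_adj (r n.+1) (r n.+2) := radj n.+1; rewrite rSn.
case/orP=> [/(coded_child_label adb)[b' adb' ->]|]; first by exists b'.
have := coded_child_rcons adb => /[swap] /coded_parent_uniq /[apply].
by rewrite -rn => /rinj; lia.
Qed.

Section CodedIBN.
Variable R : realType.
Local Open Scope ring_scope.

(** Pour a mass [kappa] at the root and let it split evenly at each branching.
    If a cutset were lighter than [kappa], one could walk down from the root so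
    that at each vertex the part of the cutset below it is lighter than the
    mass received.  The edge into such a vertex is not in the cutset, since
    its own weight would be at least that mass, so the walk is a ray that
    avoids the cutset. *)
Lemma cutset_inf_ge (lambda kappa : R) :
    (forall n, kappa / 2 ^+ branchings n <= expR (- (n%:R `^ lambda))) ->
  (kappa%:E <= cutset_inf coded_tree lambda)%E.
Proof.
move=> hk; apply/ereal_infP => _ [p pcut <-].
set phi := fun e : T * T => (expR (- ((depth coded_tree e.2)%:R `^ lambda)))%:E.
rewrite leNgt; apply/negP => small.
have phi0 e : (0 <= phi e)%E by rewrite lee_fin expR_ge0.
pose below d := [set e | p e /\
  exists2 d', admissible d' & e.2 = label d' /\ prefix d d'].
pose mass d := (\esum_(e in below d) phi e)%E.
pose share n := kappa / 2 ^+ branchings n.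
pose next d :=
  if (mass (rcons d false) < (share (size d).+1)%:E)%E then rcons d false
  else rcons d true.
pose light d := admissible d /\ (mass d < (share (size d))%:E)%E.
have sub_below d b : below (rcons d b) `<=` below d.
  move=> e [pe [d' ad' [ed' dd']]]; split => //; exists d' => //; split=> //.
  exact: prefix_trans (prefix_rcons _ _) dd'.
have light_next d : light d -> light (next d).
  move=> [ad md]; rewrite /light /next; case: ifPn => [mF|].
    by rewrite size_rcons admissible_rcons ad.
  rewrite -leNgt => mF; rewrite size_rcons admissible_rcons ad /=.
  have [brd|brd] := boolP (br (size d)); last first.
    have := esum_le_subset (@sub_below d false) phi0.
    move=> /(le_trans mF)/le_lt_trans-/(_ _ md); rewrite lte_fin.
    by rewrite /share branchingsS (negbTE brd) addn0 ltxx.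
  (* If the child [true] is too heavy as well, then so is [d]. *)
  split=> //; rewrite ltNge; apply/negP => mT.
  move: md; apply/negP; rewrite -leNgt.
  rewrite [leRHS](esumID (below (rcons d true)))//.
  rewrite (_ : _ `&` below (rcons d true) = below (rcons d true)); last first.
    exact/setIidr/sub_below.
  have -> : (share (size d))%:E =
      ((share (size d).+1)%:E + (share (size d).+1)%:E)%E.
    rewrite -EFinD /share branchingsS brd addn1 exprS invfM.
    by rewrite -mulrDr -mulrDl -[2^-1]div1r -splitr mul1r.
  apply: leeD mT _; apply: le_trans mF _.
  apply: esum_le_subset => // e eF; split; first exact: sub_below eF.
  move=> [_ [d' ad' [ed' dd']]]; have [_ [d'' ad'' [ed'' dd'']]] := eF.
  have d''E : d'' = d' by apply: label_inj => //; rewrite -ed' -ed''.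
  move: dd' dd''; rewrite d''E !prefixE !size_rcons => /eqP-> /eqP/rcons_inj.
  by case.
pose D n := iter n next [::].
have lightD n : light (D n).
  elim: n => [|n IH]; last by rewrite /D iterS; exact: light_next.
  split=> //; rewrite /share /= expr0 divr1; apply: le_lt_trans small.
  by apply: esum_le_subset => // e [].
have nextE d : exists b, next d = rcons d b.
  by rewrite /next; case: ifP => _; [exists false|exists true].
have sizeD n : size (D n) = n.
  elim: n => //= n; rewrite -/(D n); have [b ->] := nextE (D n).
  by rewrite size_rcons => ->.
have rayD : ray coded_tree (fun n => label (D n)).
  split=> // [n|n m /label_inj]; last first.
    move=> /(_ (proj1 (lightD n)) (proj1 (lightD m))) /(congr1 size).
    by rewrite !sizeD.
  have := proj1 (lightD n.+1); rewrite /D iterS -/(D n).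
  have [b ->] := nextE (D n) => adb.
  by rewrite /= /coded_adj coded_child_rcons.
have [[e1 e2] [[pe [n _ [_ ne2]]] _]] := pcut.2 _ rayD.
have [aD mD] := lightD n.+1.
have : (phi (e1, e2) <= mass (D n.+1))%E.
  rewrite -(esum_set1 (a := phi))//; apply: esum_le_subset => // _ ->.
  by split=> //; exists (D n.+1) => //=; rewrite prefix_refl.
move=> /le_lt_trans-/(_ _ mD); rewrite lte_fin /= -ne2 depth_label//.
by rewrite ltNge hk.
Qed.

(** The edges that end at depth [n] form a cutset. *)
Lemma cutset_inf_le (lambda : R) (B : set T) n :
    (0 < n)%N -> finite_set B ->
    (forall d, admissible d -> size d = n -> B (label d)) ->
  (cutset_inf coded_tree lambda <=
    (expR (- (n%:R `^ lambda)) *+ #|` fset_set B|)%:E)%E.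
Proof.
move=> n0 finB labB.
pose p := [set e | tree_edge coded_tree e /\ depth coded_tree e.2 = n].
have pcut : cutset coded_tree p.
  split=> [e []//|r /ray_label rl].
  have [d [b [dn adb rd rdb]]] := rl n.-1.
  have ad : admissible d by move: adb; rewrite admissible_rcons => /andP[].
  exists (r n.-1, r n.-1.+1); split.
    split; last by exists n.-1.
    split; last by rewrite /= rdb depth_label// size_rcons dn prednK.
    rewrite /tree_edge /= rd rdb.
    have : children coded_tree (label d) (label (rcons d b)).
      rewrite children_label//; exists b => //.
      by move: adb; rewrite admissible_rcons => /andP[].
    by [].
  move=> e [[_ en] [m _ eE]]; subst e.
  have [d' [b' [d'm adb' _ rm]]] := rl m.
  have <- : m.+1 = n by rewrite -en /= rm depth_label// size_rcons d'm.
  by [].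
apply: le_trans (ereal_inf_lbound (ex_intro2 _ _ p pcut erefl)) _.
apply: (esum_le_card (g := snd)) => //.
- have edgeE u v : tree_edge coded_tree (u, v) ->
    exists d b, [/\ admissible (rcons d b), u = label d & v = label (rcons d b)].
    move=> uv; have [[d ad /= uE] _] := coded_adj_vert (proj1 uv); subst u.
    have : children coded_tree (label d) v := uv.
    rewrite children_label// => -[b bd <-].
    by exists d, b; rewrite admissible_rcons ad.
  move=> [u v] [u' v'] /set_mem [/edgeE[d [b [adb -> ->]]] _].
  move=> /set_mem [/edgeE[d' [b' [adb' -> ->]]] _] /=.
  by move=> /(label_inj adb adb')/rcons_inj[-> ->].
- move=> [u v] [uv]; have [_ [d ad <-]] := coded_adj_vert (proj1 uv).
  by rewrite /= depth_label// => dn; exact: labB.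
- by move=> e [_ ->].
Qed.

End CodedIBN.
End CodedTree.

(** * Balls and spheres in Cayley graphs *)

Section Balls.
Variables (W : groupType) (S : set W).
Local Open Scope group_scope.

Fixpoint products n : set W :=
  if n is m.+1 then [set w | exists u s, [/\ products m u, S s & w = u * s]]
  else [set 1].

Lemma products_add m n u v :
  products m u -> products n v -> products (m + n)%N (u * v).
Proof.
move=> mu; elim: n v => [v -> |n IH v [v' [s [nv' Ss ->]]]].
  by rewrite mulg1 addn0.
by rewrite addnS; exists (u * v'), s; split; rewrite ?mulgA//; exact: IH.
Qed.

Lemma products_split m n w : products (m + n)%N w ->
  exists u v, [/\ products m u, products n v & w = u * v].
Proof.
elim: n w => [|n IH] w; first by rewrite addn0 => mw; exists w, 1; rewrite mulg1.
rewrite addnS => -[_ [s [/IH[u [v [mu nv ->]]] Ss ->]]].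
by exists u, (v * s); split; rewrite ?mulgA//; exists v, s.
Qed.

Lemma walk_productsP x y n :
  walk_of_length (cayley S) x y n <-> exists2 u, products n u & y = x * u.
Proof.
split=> [[p [xp <- <-]]|[u nu ->]].
  elim/last_ind: p xp => [_|p z IH]; first by exists 1; rewrite ?mulg1.
  rewrite rcons_path last_rcons size_rcons => /andP[/IH[u pu ->]].
  by move=> /asboolP[s Ss ->]; exists (u * s); rewrite ?mulgA//; exists u, s.
elim: n u nu => [_ ->|n IH _ [u [s [/IH[p [xp lp sp]] Ss ->]]]].
  by exists [::]; rewrite /= mulg1.
exists (rcons p (x * (u * s))).
rewrite rcons_path last_rcons size_rcons xp sp lp; split=> //=.
by apply/asboolP; exists s; rewrite ?mulgA.
Qed.

Lemma sphere_products n : sphere (cayley S) 1 n =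
  [set w | products n w /\ forall m, products m w -> (n <= m)%N].
Proof.
apply/seteqP; split=> w /= [].
  move=> /walk_productsP[u nu]; rewrite mul1g => -> minw; split=> // m mu.
  by apply: minw; apply/walk_productsP; exists u => //; rewrite mul1g.
move=> nw minw; split; first by apply/walk_productsP; exists w; rewrite ?mul1g.
by move=> m /walk_productsP[u mu]; rewrite mul1g => wu; apply: minw; rewrite wu.
Qed.

Definition cayley_ball n : set W := [set w | exists2 m, (m <= n)%N & products m w].

Lemma sphere_sub_ball n : sphere (cayley S) 1 n `<=` cayley_ball n.
Proof. by rewrite sphere_products => w [nw _]; exists n. Qed.

(** Cut a geodesic after its first [n] steps. *)
Lemma ball_sub_sphere_mul n m : (n <= m)%N ->
  cayley_ball (n + m)%N `<=`
    [set x.1 * x.2 | x in (1 |` sphere (cayley S) 1 n) `*` cayley_ball m].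
Proof.
move=> nm w [k0 k0nm k0w].
have [k kw kmin] : exists2 k, products k w &
    forall j, products j w -> (k <= j)%N.
  have : exists k, `[< products k w >] by exists k0; apply/asboolP.
  case/ex_minnP => k /asboolP kw kmin; exists k => // j jw; apply: kmin.
  exact/asboolP.
have kk0 := kmin _ k0w.
have [km|mk] := leqP k m.
  exists (1, w); rewrite /= ?mul1g//; split; first by left.
  by exists k.
have kE : k = (n + (k - n))%N by lia.
move: (kw); rewrite {1}kE => /products_split[u [v [nu kv wE]]].
exists (u, v); rewrite /= ?wE//; split; last by exists (k - n)%N; first lia.
right; rewrite sphere_products; split=> // j ju.
have := kmin (j + (k - n))%N; rewrite wE => /(_ (products_add ju kv)); lia.
Qed.

Hypothesis finite_ball : forall n, finite_set (cayley_ball n).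

Lemma finite_sphere n : finite_set (sphere (cayley S) 1 n).
Proof. exact: sub_finite_set (@sphere_sub_ball n) (finite_ball n). Qed.

Lemma card_ball_add n m : (n <= m)%N ->
  (#|` fset_set (cayley_ball (n + m)%N)| <=
   #|` fset_set (sphere (cayley S) 1%g n)|.+1 * #|` fset_set (cayley_ball m)|)%N.
Proof.
move=> nm; set E := fset_set (sphere _ _ _); set B := fset_set (cayley_ball m).
pose P := [seq u * v | u <- 1 :: E, v <- B].
have <- : size P = (#|` E|.+1 * #|` B|)%N by rewrite size_allpairs.
apply: uniq_leq_size => [|w]; first exact: fset_uniq.
rewrite in_fset_set// => /set_mem.
move=> /(ball_sub_sphere_mul nm)[[u v] [/= u1E vB] <-].
apply: allpairs_f; last by rewrite in_fset_set ?mem_set.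
rewrite inE; case: u1E => [->|uE]; first by rewrite eqxx.
by rewrite in_fset_set ?mem_set ?orbT//; exact: finite_sphere.
Qed.

(** Spheres need not grow monotonically; once the growth of balls is known
    from both sides, this bounds the spheres from below. *)
Lemma card_ball_mul n K :
  (#|` fset_set (cayley_ball (K.+1 * n)%N)| <=
   #|` fset_set (sphere (cayley S) 1%g n)|.+1 ^ K *
   #|` fset_set (cayley_ball n)|)%N.
Proof.
elim: K => [|K IH]; first by rewrite mul1n expn0 mul1n.
rewrite mulSn; apply: leq_trans (card_ball_add _) _; first by rewrite mulSn leq_addr.
by rewrite expnS -mulnA leq_mul2l IH orbT.
Qed.

End Balls.

(** * Self-similarity of the Grigorchuk group *)

Definition grig_elt (g : taut) (gP : grig_gens g) : grigorchuk :=
  exist _ g (mem_set (sub_subgroup_gen gP)).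

Definition ga : grigorchuk := grig_elt (Or41 _ _ _ (erefl taut_a)).
Definition gb : grigorchuk := grig_elt (Or42 _ _ _ (erefl taut_b)).
Definition gc : grigorchuk := grig_elt (Or43 _ _ _ (erefl taut_c)).
Definition gd : grigorchuk := grig_elt (Or44 _ _ _ (erefl taut_d)).

(** The group [{1, b, c, d}] is a Klein four-group; it is coded by pairs of
    bits so that its product is the bitwise sum.  The first bit of [x] tells
    whether [x] acts as [a] behind the letter 0. *)
Definition klein : Type := bool * bool.

Definition kmul (x y : klein) : klein := (x.1 (+) y.1, x.2 (+) y.2).

(** The sections behind the letter 1: [b -> c -> d -> b]. *)
Definition knext (x : klein) : klein := (x.2, x.1 (+) x.2).

Definition kval (x : klein) : grigorchuk :=
  match x with
  | (true, true) => gb | (true, false) => gc | (false, true) => gd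
  | (false, false) => 1%g
  end.

Lemma kval_cons (x : klein) y w : val (kval x) (y :: w) =
  y :: if y then val (kval (knext x)) w else if x.1 then grig_a w else w.
Proof. by case: x y => [[] []] []; reflexivity. Qed.

Lemma kval_nil (x : klein) : val (kval x) [::] = [::].
Proof. by case: x => [[] []]; reflexivity. Qed.

Lemma kvalM x y : (kval x * kval y)%g = kval (kmul x y).
Proof.
apply: val_inj; apply: taut_eqP => w.
rewrite -[LHS]/(val (kval y) (val (kval x) w)).
elim: w x y => [|z w IH] x y; first by rewrite !kval_nil.
rewrite !kval_cons; case: z; first by rewrite IH; case: x y => [[] []] [[] []].
by case: x y => [[] []] [[] []] //=; rewrite grig_aK.
Qed.

Definition scons (y : bool) (xi : nat -> bool) : nat -> bool :=
  fun n => if n is m.+1 then xi m else y.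

Lemma scons_inj y y' xi xi' : scons y xi = scons y' xi' -> y = y' /\ xi = xi'.
Proof.
move=> e; split; first exact: (congr1 (@^~ 0%N) e).
by apply: funext => n; exact: (congr1 (@^~ n.+1) e).
Qed.

Lemma scons_ones : scons true all_ones = all_ones.
Proof. by apply: funext => -[]. Qed.

Lemma taut_act_scons (g h : taut) y e xi :
    (forall u, g (y :: u) = (y (+) e) :: h u) ->
  taut_act (scons y xi) g = scons (y (+) e) (taut_act xi h).
Proof.
have mk n : mkseq (scons y xi) n.+1 = y :: mkseq xi n.
  by rewrite /mkseq /= -[1%N]addn0 iotaDl -map_comp.
by move=> gh; apply: funext => -[|n]; rewrite /taut_act mk gh.
Qed.

Lemma kval_ones x : taut_act all_ones (val (kval x)) = all_ones.
Proof.
apply: funext => n; rewrite /taut_act.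
have -> : mkseq all_ones n.+1 = nseq n.+1 true.
  by apply: (@eq_from_nth _ false) => [|i]; rewrite size_mkseq ?size_nseq// => ilt;
    rewrite nth_mkseq// nth_nseq ilt.
have -> m : val (kval x) (nseq m true) = nseq m true.
  elim: m x => [|m IH] x; first exact: kval_nil.
  by rewrite -[nseq m.+1 true]/(true :: nseq m true) kval_cons IH.
by rewrite nth_nseq ltnSn.
Qed.

(** The property is stable under quotients, so that it has to be checked on
    the generators only. *)
Lemma grig_sections (g : grigorchuk) : exists e (h : bool -> grigorchuk),
  forall y u, val g (y :: u) = (y (+) e) :: val (h y) u.
Proof.
pose H : set taut := [set g : taut | exists e (h : bool -> grigorchuk),
  forall y u, g (y :: u) = (y (+) e) :: val (h y) u].
have : H (val g); last by [].
have /set_mem : val g \in subgroup_gen grig_gens := valP g.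
apply; split; last first.
  have kH x : H (val (kval x)).
    exists false,
      (fun y => if y then kval (knext x) else if x.1 then ga else 1%g).
    by move=> y u; rewrite kval_cons addbF; case: y => //; case: x.1.
  move=> f /= [] ->; [|exact: (kH (true, true))|exact: (kH (true, false))|
    exact: (kH (false, true))].
  by exists true, (fun=> 1%g) => y u /=; rewrite addbT.
split=> [|f f' /set_mem[e [h fh]] /set_mem[e' [h' fh']]]; apply/mem_set.
  by exists false, (fun=> 1%g) => y u; rewrite addbF.
exists (e (+) e'), (fun y => h y * (h' (y (+) e (+) e'))^-1)%g => y u.
rewrite /= fh addbA; apply: (can_inj (taut_funK f')).
by rewrite taut_invK fh' addbK taut_invK.
Qed.

(** As [x0 = 1 x0], the tail of [x0 g] is the image of [x0] under the section
    of [g] behind the letter 1. *)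
Lemma orb_tail (x : orbX) : exists y (z : orbX), val x = scons y (val z).
Proof.
have /set_mem[g _ xE] := valP x; have [e [h gh]] := grig_sections g.
exists (~~ e), (orb_act orb0 (h true)); rewrite -[LHS]xE -{1}scons_ones.
by rewrite (taut_act_scons _ (gh true)).
Qed.

(** * The upper bound on the growth of the wreath product *)

Section SelfSimilarWreath.
Variable A : finGroupType.
Local Notation W := (grig_wreath A).
Local Open Scope group_scope.

(** The recursion [W -> (W x W) x| Z/2] extending that of the Grigorchuk
    group: [x0 = 1 x0] puts the lamp generators behind the letter 1. *)
Definition decomposes (w : W) (e : bool) (h : bool -> W) : Prop :=
  (forall y u, val (wr_top w) (y :: u) = (y (+) e) :: val (wr_top (h y)) u) /\
  (forall y (x z : orbX), val x = scons (y (+) e) (val z) ->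
     wr_fun w x = wr_fun (h y) z).

Lemma decomposesM w w' e e' h h' :
  decomposes w e h -> decomposes w' e' h' ->
  decomposes (w * w') (e (+) e') (fun y => h y * h' (y (+) e)).
Proof.
move=> [wt wf] [wt' wf']; split=> [y u|y x z xz].
  by rewrite addbA -wt' -wt.
rewrite /= (wf' (y (+) e) x z) -?addbA//; congr (_ * _).
apply: wf; set g := wr_top w'; set g' := wr_top (h' (y (+) e)).
have xE : val x = taut_act (scons (y (+) e) (val (orb_action z g'^-1))) (val g).
  rewrite (taut_act_scons _ (wt' (y (+) e))) -addbA xz; congr scons.
  exact: (congr1 val (esym (ractVK orb_action g' z))).
by rewrite -[LHS]/(taut_act (val x) (val g^-1)) xE -taut_actM mulgV taut_act1.
Qed.

Lemma decomposes_inj w w' e h h' :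
  decomposes w e h -> decomposes w' e h' -> h =1 h' -> w = w'.
Proof.
move=> [wt wf] [wt' wf'] hh'; apply: wreath_eqP => [x|].
  have [y [z xyz]] := orb_tail x; rewrite (wf (y (+) e) x z) ?addbK//.
  by rewrite (wf' (y (+) e) x z) ?addbK// hh'.
apply: val_inj; apply: taut_eqP => -[|y u]; last by rewrite wt wt' hh'.
by apply: (@eq_trans _ _ [::]); [|apply/esym]; apply/size0nil;
  rewrite taut_size.
Qed.

Definition vertex_letter : Type := A * klein.
Implicit Types k : vertex_letter.

Definition letter_val k : W :=
  Wreath orb_action (kval k.2) (@wr_base_finite _ _ orb0 k.1).

Definition letter_mul k k' : vertex_letter := (k.1 * k'.1, kmul k.2 k'.2).

Lemma kval_orb0 x (z : orbX) : (orb_act z (kval x) == orb0) = (z == orb0).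
Proof.
have k0 : orb_act orb0 (kval x) = orb0 by apply: val_inj; exact: kval_ones.
by rewrite -{1}k0 (inj_eq (can_inj (ractK orb_action (kval x)))).
Qed.

(** The lamp generators commute with [b], [c] and [d], which fix [x0]. *)
Lemma letter_valM k k' :
  letter_val k * letter_val k' = letter_val (letter_mul k k').
Proof.
apply: wreath_eqP => [z|] /=; last exact: kvalM.
have zE : orb_act (orb_act z (kval k'.2)^-1) (kval k'.2) = z.
  exact: (ractVK orb_action).
rewrite -(kval_orb0 k'.2 (orb_act z (kval k'.2)^-1)) zE.
by case: ifP => _; rewrite ?mulg1.
Qed.

Definition aval : W := wr_lift A orb_action ga.

(** The word [k0 a k1 a k2 ... a km].  Trivial letters [ki] are allowed, so
    that words are never reduced. *)
Definition aword : Type := vertex_letter * seq vertex_letter.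

Definition aword_val (u : aword) : W :=
  letter_val u.1 * \prod_(k <- u.2) (aval * letter_val k).

Definition letter_one : vertex_letter := (1, (false, false)).

Definition cons_a (u : aword) : aword := (letter_one, u.1 :: u.2).
Definition cons_letter k (u : aword) : aword := (letter_mul k u.1, u.2).

Lemma letter_val1 : letter_val letter_one = 1.
Proof. by apply: wreath_eqP => // z /=; rewrite if_same. Qed.

Lemma aword_val_cons_a u : aword_val (cons_a u) = aval * aword_val u.
Proof. by rewrite /aword_val big_cons letter_val1 mul1g -mulgA. Qed.

Lemma aword_val_cons_letter k u :
  aword_val (cons_letter k u) = letter_val k * aword_val u.
Proof. by rewrite /aword_val mulgA letter_valM. Qed.

(** Behind 1 the section of [k] is a letter, which merges with the first one
    of [u]; behind 0 it is [a] or trivial. *)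
Definition cons_section (y : bool) k (u : aword) : aword :=
  if y then cons_letter (k.1, knext k.2) u
  else if k.2.1 then cons_a u else u.

(** Each [a] exchanges the two subtrees, so that the letters are read
    alternately behind [y] and behind [~~ y]. *)
Fixpoint word_section (y : bool) k (ks : seq vertex_letter) : aword :=
  cons_section y k
    (if ks is k' :: ks' then word_section (~~ y) k' ks' else (letter_one, [::])).

Lemma decomposes_letter k : decomposes (letter_val k) false
  (fun y => if y then letter_val (k.1, knext k.2)
            else if k.2.1 then aval else 1).
Proof.
split=> [y u|y x z].
  by rewrite kval_cons addbF; case: y => //; case: k.2.1.
rewrite addbF /= => xz; have -> : (x == orb0) = y && (z == orb0).
  apply/eqP/andP => [x0|[y1 /eqP z0]].
    move: xz; rewrite x0 -[LHS]scons_ones => /scons_inj[<- /= z0].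
    by split=> //; apply/eqP/val_inj.
  by apply: val_inj; apply: (eq_trans xz); rewrite y1 z0; exact: scons_ones.
by case: y {xz} => //=; case: k.2.1.
Qed.

Lemma decomposes_a : decomposes aval true (fun=> 1).
Proof. by split=> [y u|//]; rewrite addbT. Qed.

Lemma cons_section_val y k u : aword_val (cons_section y k u) =
  (if y then letter_val (k.1, knext k.2) else if k.2.1 then aval else 1)
  * aword_val u.
Proof.
rewrite /cons_section; case: y; first exact: aword_val_cons_letter.
by case: k.2.1; rewrite ?aword_val_cons_a ?mul1g.
Qed.

Lemma decomposes_section k ks : decomposes (aword_val (k, ks)) (odd (size ks))
  (fun y => aword_val (word_section y k ks)).
Proof.
elim: ks k => [|k' ks IH] k.
  have -> : aword_val (k, [::]) = letter_val k.
    by rewrite /aword_val big_nil mulg1.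
  have := decomposes_letter k; congr decomposes; apply: funext => y.
  by rewrite /= cons_section_val /aword_val big_nil letter_val1 !mulg1.
have -> : aword_val (k, k' :: ks) = letter_val k * (aval * aword_val (k', ks)).
  by rewrite /aword_val big_cons !mulgA.
have := decomposesM (decomposes_letter k) (decomposesM decomposes_a (IH k')).
congr decomposes; apply: funext => y.
by rewrite /= cons_section_val addbF addbT mul1g.
Qed.

Section Weights.
Variable R : realType.
Local Open Scope ring_scope.
Variable eta : R.
Hypothesis eta01 : 0 < eta < 1.
Hypothesis etaE : eta ^+ 3 + eta ^+ 2 + eta = 2.

Definition aweight : R := 1 - eta ^+ 3.
Definition kweight (x : klein) : R :=
  match x with
  | (true, true) => eta ^+ 3 | (true, false) => 1 - eta ^+ 2
  | (false, true) => 1 - eta | (false, false) => 0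
  end.

Let eta_ineqs : [/\ eta ^+ 3 = 2 - eta - eta ^+ 2, 0 < eta ^+ 3,
  eta ^+ 3 < eta ^+ 2, eta ^+ 2 < eta & (0 < eta /\ eta < 1)].
Proof.
have /andP[e0 e1] := eta01; split=> //; first by move: etaE; lra.
- by rewrite exprn_gt0.
- by rewrite exprS -[ltRHS]mul1r ltr_pM2r// exprn_gt0.
- by rewrite expr2 -[ltRHS]mul1r ltr_pM2r.
Qed.

Lemma aweight_gt0 : 0 < aweight.
Proof. by have [h3 p3 h32 h21 [e0 e1]] := eta_ineqs; rewrite /aweight; lra. Qed.

Lemma kweight_ge0 x : 0 <= kweight x.
Proof.
by have [h3 p3 h32 h21 [e0 e1]] := eta_ineqs; case: x => [[] []] /=; lra.
Qed.

Lemma kweightM x y : kweight (kmul x y) <= kweight x + kweight y.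
Proof.
have [h3 p3 h32 h21 [e0 e1]] := eta_ineqs.
by case: x y => [[] []] [[] []] /=; lra.
Qed.

(** The weights are chosen to make this contraction an equality for [b], [c]
    and [d]. *)
Lemma kweight_contract (x : klein) :
  (if x.1 then aweight else 0) + kweight (knext x) <= eta * (aweight + kweight x).
Proof.
have [h3 p3 h32 h21 [e0 e1]] := eta_ineqs.
have h3' : eta * eta ^+ 2 = eta ^+ 3 by rewrite -exprS.
have h2' : eta * eta = eta ^+ 2 by rewrite expr2.
have aE : aweight = eta + eta ^+ 2 - 1 by rewrite /aweight h3; ring.
rewrite aE; case: x => [[] []] /=; rewrite ?h3; nra.
Qed.

Definition aword_weight (u : aword) : R :=
  kweight u.1.2 + \sum_(k <- u.2) (aweight + kweight k.2).

Lemma aword_weight_ge0 u : 0 <= aword_weight u.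
Proof.
rewrite addr_ge0 ?kweight_ge0// sumr_ge0// => k _.
by rewrite addr_ge0 ?kweight_ge0// ltW// aweight_gt0.
Qed.

Lemma aword_weight_cons_a u :
  aword_weight (cons_a u) = aweight + aword_weight u.
Proof. by rewrite /aword_weight /= big_cons add0r addrA. Qed.

Lemma aword_weight_cons_letter k u :
  aword_weight (cons_letter k u) <= kweight k.2 + aword_weight u.
Proof. by rewrite /aword_weight addrA lerD2r kweightM. Qed.

Lemma aword_weight_cons_section k u v :
  aword_weight (cons_section false k u) + aword_weight (cons_section true k v)
  <= eta * (aweight + kweight k.2) + (aword_weight u + aword_weight v).
Proof.
have := kweight_contract k.2.
have := aword_weight_cons_letter (k.1, knext k.2) v.
rewrite /cons_section; case: k.2.1; rewrite ?aword_weight_cons_a /=; lra.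
Qed.

(** The extra [aweight] pairs the last letter, which no [a] follows. *)
Lemma section_weight k ks :
  aword_weight (word_section false k ks) + aword_weight (word_section true k ks)
  <= eta * (aword_weight (k, ks) + aweight).
Proof.
elim: ks k => [|k' ks IH] k /=; apply: le_trans (aword_weight_cons_section _ _ _) _.
  by rewrite /aword_weight /= !big_nil; lra.
have := IH k'; rewrite /aword_weight /= big_cons; lra.
Qed.

(** Finite trees of words, serialised: the portrait of an element down to
    some depth, with words at the leaves. *)
Definition code_symbol : finType := (bool + option (A * (bool * bool)))%type.

Fixpoint encodes (n : nat) (t : seq code_symbol) (w : W) : Prop :=
  if n is m.+1 then exists e t0 t1 (h : bool -> W),
    [/\ t = inl e :: t0 ++ t1, encodes m t0 (h false), encodes m t1 (h true)
      & decomposes w e h]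
  else exists k ks, t = rcons (map (inr \o some) (k :: ks)) (inr None) /\
                    w = aword_val (k, ks).

(** Codes are self-delimiting, hence the remainders [r] and [r']. *)
Lemma encodes_functional n t t' r r' w w' :
    encodes n t w -> encodes n t' w' -> t ++ r = t' ++ r' ->
  [/\ t = t', r = r' & w = w'].
Proof.
elim: n t t' r r' w w' => [|n IH] t t' r r' w w'.
  move=> [k [ks [-> ->]]] [k' [ks' [-> ->]]].
  suff : forall s s' : seq (A * (bool * bool)),
      rcons (map (inr \o some) s) (inr None) ++ r =
      rcons (map (inr \o some) s') (inr None) ++ r' :> seq code_symbol ->
      s = s' /\ r = r'.
    by move=> /[apply] -[[-> ->] ->].
  elim=> [|x s IH] [|x' s'] //=; first by case.
  by move=> -[-> /IH[-> ->]].
move=> [e [t0 [t1 [h [-> ht0 ht1 dw]]]]] [e' [t0' [t1' [h' [-> ht0' ht1' dw']]]]].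
move=> [ee']; rewrite -!catA => /(IH _ _ _ _ _ _ ht0 ht0')[-> + h0].
move=> /(IH _ _ _ _ _ _ ht1 ht1')[-> -> h1]; rewrite ee'; split=> //.
by rewrite -ee' in dw'; apply: decomposes_inj dw dw' _; case.
Qed.

(** Each level multiplies the total weight by [eta], up to [eta * aweight] for
    each word; these corrections add up to the order of [2 ^ n]. *)
Lemma encodes_size n u : exists2 t, encodes n t (aword_val u) &
  (size t)%:R <= eta ^+ n * (aword_weight u / aweight) + 4 * 2 ^+ n - 2 :> R.
Proof.
have a0 := aweight_gt0; have /andP[e0 e1] := eta01.
elim: n u => [|n IH] [k ks].
  exists (rcons (map (inr \o some) (k :: ks)) (inr None)); first by exists k, ks.
  rewrite size_rcons /= size_map expr0 mul1r.
  have : (size ks)%:R <= aword_weight (k, ks) / aweight.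
    rewrite ler_pdivlMr// mulr_natl /aword_weight /= big_split /=.
    rewrite big_const_seq count_predT iter_addr_0.
    have := kweight_ge0 k.2.
    have : 0 <= \sum_(j <- ks) kweight j.2.
      by rewrite sumr_ge0// => j _; exact: kweight_ge0.
    lra.
  by rewrite -[(size ks).+2]addn2 natrD; lra.
have [t0 et0 st0] := IH (word_section false k ks).
have [t1 et1 st1] := IH (word_section true k ks).
exists (inl (odd (size ks)) :: t0 ++ t1).
  exists (odd (size ks)), t0, t1, (fun y => aword_val (word_section y k ks)).
  by split=> //; exact: decomposes_section.
rewrite /= size_cat -natr1 natrD.
have := section_weight k ks.
rewrite -(ler_pM2r (x := eta ^+ n / aweight)); last by rewrite divr_gt0// exprn_gt0.
have -> : eta * (aword_weight (k, ks) + aweight) * (eta ^+ n / aweight) =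
  eta ^+ n.+1 * (aword_weight (k, ks) / aweight) + eta ^+ n.+1.
  by rewrite exprS; field; rewrite gt_eqF.
have : eta ^+ n.+1 <= 1 by rewrite exprn_ile1// ltW.
move: st0 st1; rewrite !(exprS 2) [(aword_weight _ + _) * _]mulrDl.
rewrite ![eta ^+ n * (_ / _)]mulrCA; lra.
Qed.

End Weights.
End SelfSimilarWreath.

Section UpperBound.
Variables (A : finGroupType) (SA : {set A}).
Local Notation W := (grig_wreath A).
Local Notation S := (grig_wreath_gens SA).

Lemma encodable_card n M (E : set W) :
    (forall w, E w -> exists2 t, encodes n t w & (size t <= M)%N) ->
  finite_set E /\
  (#|` fset_set E| <= #|{: option (code_symbol A)}| ^ M)%N.
Proof.
move=> Ecode.
pose f (x : M.-tuple (option (code_symbol A))) : W :=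
  xget 1%g [set w | encodes n (pmap id x) w].
(* Codes are padded with [None] to the common length [M]. *)
have Ef w : E w -> exists x, f x = w.
  move=> /Ecode[t tw tM].
  have sx : size (map some t ++ nseq (M - size t) None) == M.
    by rewrite size_cat size_map size_nseq subnKC.
  exists (Tuple sx); rewrite /f /=.
  have -> : pmap id (map some t ++ nseq (M - size t) None) = t.
    rewrite pmap_cat (_ : pmap id (nseq _ _) = [::]); last by elim: (M - _)%N.
    by rewrite cats0; elim: (t) => //= x s ->.
  case: xgetP => [w' _ tw'|/(_ w)//].
  by have [] := encodes_functional tw' tw (erefl (t ++ [::])).
have finE : finite_set E.
  apply: (@sub_finite_set _ _ (f @` setT)); last exact/finite_image/finite_finset.
  by move=> w /Ef[x <-]; exists x.
split=> //; rewrite -card_tuple cardE -(size_map f).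
apply: uniq_leq_size => [|w]; first exact: fset_uniq.
rewrite in_fset_set// => /set_mem/Ef[x <-].
by apply: map_f; rewrite mem_enum.
Qed.

Section Weights.
Variable R : realType.
Local Open Scope ring_scope.
Variable eta : R.
Hypothesis eta01 : 0 < eta < 1.
Hypothesis etaE : eta ^+ 3 + eta ^+ 2 + eta = 2.

Lemma products_aword n w : products S n w ->
  exists2 u, aword_val u = w & aword_weight eta u <= n%:R.
Proof.
have e12 : 0 <= eta ^+ 2 by rewrite exprn_ge0//; move: eta01; lra.
have e13 : 0 <= eta ^+ 3 by rewrite exprn_ge0//; move: eta01; lra.
have e13' : eta ^+ 3 <= 1 by rewrite exprn_ile1//; move: eta01; lra.
elim: n w => [|n IH] w.
  move=> ->; exists (letter_one A, [::]); last by rewrite /aword_weight big_nil addr0.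
  by rewrite /aword_val big_nil letter_val1 mulg1.
rewrite -add1n => /products_split[_ [v [[_ [s [-> Ss ->]]] /IH[u <- un] ->]]].
rewrite mul1g; suff [u' u'E u'u] : exists2 u', aword_val u' = (s * aword_val u)%g &
    aword_weight eta u' <= 1 + aword_weight eta u.
  by exists u' => //; rewrite natrD; apply: le_trans u'u _; rewrite lerD2l.
have kcase x : kweight eta x <= 1 -> exists2 u',
    aword_val u' = (wr_lift A orb_action (kval x) * aword_val u)%g &
    aword_weight eta u' <= 1 + aword_weight eta u.
  move=> x1; exists (cons_letter (1%g, x) u).
    rewrite aword_val_cons_letter; congr (_ * _)%g.
    by apply: wreath_eqP => // z /=; rewrite if_same.
  apply: le_trans (aword_weight_cons_letter eta01 etaE _ _) _.
  by rewrite lerD2r.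
case: Ss => [[a _ <-]|[g gS <-]].
  exists (cons_letter (a, (false, false)) u); first exact: aword_val_cons_letter.
  apply: le_trans (aword_weight_cons_letter eta01 etaE _ _) _.
  by rewrite lerD2r.
case: gS => gE.
- have -> : g = ga by exact: val_inj.
  exists (cons_a u); first exact: aword_val_cons_a.
  by rewrite aword_weight_cons_a lerD2r /aweight; lra.
- have -> : g = kval (true, true) by exact: val_inj.
  by apply: kcase.
- have -> : g = kval (true, false) by exact: val_inj.
  by apply: kcase => /=; lra.
- have -> : g = kval (false, true) by exact: val_inj.
  by apply: kcase => /=; move: eta01; lra.
Qed.

(** At depth [k], the [2 ^ k] sections of an element of length at most
    [(2 / eta) ^ k] have total weight of the order of [2 ^ k], and so has the
    code that they form. *)
Lemma ball_card_le : exists Q : nat, forall n k, n%:R <= (2 / eta) ^+ k ->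
  finite_set (cayley_ball S n) /\ (#|` fset_set (cayley_ball S n)| <= Q ^ (2 ^ k))%N.
Proof.
have /andP[e0 e1] := eta01; have a0 := aweight_gt0 eta01 etaE.
pose M := (Num.bound (aweight eta)^-1 + 4)%N.
exists (#|{: option (code_symbol A)}| ^ M)%N => n k nk.
rewrite -expnM; apply: (@encodable_card k) => w [m mn /products_aword[u <- um]].
have [t tu ts] := encodes_size eta01 etaE k u; exists t => //.
rewrite -(ler_nat R); apply: le_trans ts _.
rewrite natrM natrD natrX [leRHS]mulrDl.
have : eta ^+ k * (aword_weight eta u / aweight eta) <=
    (Num.bound (aweight eta)^-1)%:R * 2 ^+ k.
  rewrite mulrA [leRHS]mulrC; apply: ler_pM.
  - by rewrite mulr_ge0 ?exprn_ge0 ?aword_weight_ge0// ltW.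
  - by rewrite invr_ge0 ltW.
  - apply: (@le_trans _ _ (eta ^+ k * (2 / eta) ^+ k)).
      rewrite ler_pM2l ?exprn_gt0//; apply: le_trans um (le_trans _ nk).
      by rewrite ler_nat.
    by rewrite -exprMn mulrC divfK// gt_eqF.
  - by rewrite ltW// archi_boundP// invr_ge0 ltW.
lra.
Qed.

End Weights.
End UpperBound.

(** * A substitution with a large inverted orbit *)

Inductive bcd := Xb | Xc | Xd.

Definition bcd_klein (x : bcd) : klein :=
  match x with Xb => (true, true) | Xc => (true, false) | Xd => (false, true) end.

Definition bcd_val (v : seq bcd) : grigorchuk :=
  (\prod_(x <- v) (ga * kval (bcd_klein x)))%g.

Lemma bcd_val_cat u v : bcd_val (u ++ v) = (bcd_val u * bcd_val v)%g.
Proof. exact: big_cat. Qed.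

Definition letter_subst (x : bcd) : seq bcd :=
  match x with Xb => [:: Xb; Xd; Xc] | Xc => [:: Xb; Xb] | Xd => [:: Xc; Xc] end.

Definition substitute (v : seq bcd) : seq bcd := flatten (map letter_subst v).

Lemma subst_cat u v : substitute (u ++ v) = substitute u ++ substitute v.
Proof. by rewrite /substitute map_cat flatten_cat. Qed.

Definition point_act (xi : nat -> bool) (g : grigorchuk) := taut_act xi (val g).

Lemma actM xi g h : point_act xi (g * h)%g = point_act (point_act xi g) h.
Proof. exact: taut_actM. Qed.

Lemma actK g : cancel (point_act^~ g) (point_act^~ (g^-1)%g).
Proof. by move=> xi; rewrite /= -actM mulgV; exact: taut_act1. Qed.

Lemma actaK : involutive (point_act^~ ga).
Proof.
move=> xi; rewrite /= -actM (_ : ga * ga = 1)%g; first exact: taut_act1.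
by apply: val_inj; apply: taut_eqP => w; exact: grig_aK.
Qed.

Lemma act_a y xi : point_act (scons y xi) ga = scons (~~ y) xi.
Proof.
by rewrite /point_act (@taut_act_scons _ 1%g y true) ?addbT ?taut_act1.
Qed.

Lemma act_kval y xi x : point_act (scons y xi) (kval x) =
  scons y (if y then point_act xi (kval (knext x))
           else if x.1 then point_act xi ga else xi).
Proof.
rewrite /point_act (@taut_act_scons _
  (if y then val (kval (knext x)) else if x.1 then val ga else 1%g) y false).
  by rewrite addbF; case: y => //; case: x.1; rewrite ?taut_act1.
by move=> u; rewrite kval_cons addbF; case: y => //; case: x.1.
Qed.

Lemma act_kval_ones x : point_act all_ones (kval x) = all_ones.
Proof. exact: kval_ones. Qed.

(** The substitution acts behind each of the letters 0 and 1 as the original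
    word does, provided that the tail is read through [a] behind 0. *)
Definition twist (y : bool) (xi : nat -> bool) : nat -> bool :=
  scons y (if y then xi else point_act xi ga).

Lemma act_bcd1 xi x v :
  point_act xi (bcd_val (x :: v)) =
  point_act (point_act (point_act xi ga) (kval (bcd_klein x))) (bcd_val v).
Proof. by rewrite /bcd_val big_cons !actM. Qed.

Lemma act_bcd0 xi : point_act xi (bcd_val [::]) = xi.
Proof. by rewrite /bcd_val big_nil; exact: taut_act1. Qed.

Lemma act_subst v y xi : exists y',
  point_act (twist y xi) (bcd_val (substitute v)) =
  twist y' (point_act xi (bcd_val v)).
Proof.
elim: v y xi => [|x v IH] y xi; first by exists y; rewrite !act_bcd0.
suff [y' ->] : exists y',
    point_act (twist y xi) (bcd_val (letter_subst x ++ substitute v)) =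
    point_act (twist y' (point_act (point_act xi ga) (kval (bcd_klein x))))
      (bcd_val (substitute v)).
  by have [y'' ->] := IH y' (point_act (point_act xi ga) (kval (bcd_klein x)));
    exists y''; rewrite act_bcd1.
have cd z : point_act (point_act z gc) gd = point_act z gb.
  by rewrite -actM; congr point_act; exact: (kvalM (true, false) (false, true)).
exists (if x is Xb then ~~ y else y); rewrite bcd_val_cat actM; congr point_act.
by case: x; case: y; rewrite /= !act_bcd1 act_bcd0 /twist;
  rewrite !(act_a, act_kval) /= ?actaK ?cd.
Qed.

(** The points are taken along the inverse of the word, because the part of a
    word that follows a lamp is what moves it. *)
Definition visited (v : seq bcd) (xi : nat -> bool) : Prop :=
  exists u x u', v = u ++ x :: u' /\ point_act xi (bcd_val (rcons u x)) = all_ones.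

(** Just before the last letter [a x] of the prefix that brings [xi] to [x0],
    the point is at [x0 a]; the first two letters of the image of [x] then
    bring the twisted point to [x0], whatever its first letter is. *)
Lemma visited_subst v y xi : visited v xi -> visited (substitute v) (twist y xi).
Proof.
move=> [u [x [u' [-> xi1]]]].
have {xi1} xiu : point_act xi (bcd_val u) = point_act all_ones ga.
  move: xi1; rewrite -cats1 bcd_val_cat actM act_bcd1 act_bcd0 => xi1.
  apply: (can_inj actaK); rewrite actaK.
  by apply: (can_inj (actK (kval (bcd_klein x)))); rewrite xi1 act_kval_ones.
have [y' yE] := act_subst u y xi; rewrite xiu in yE.
have first_bc : exists f g r, letter_subst x = f :: g :: r /\ (bcd_klein f).1.
  by case: x; do 3 eexists.
have {first_bc}[f [g [r [xE f1]]]] := first_bc.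
rewrite subst_cat -[substitute (x :: u')]/(letter_subst x ++ substitute u') xE.
have [y'1|y'0] := boolP y'.
  exists (substitute u ++ [:: f]), g, (r ++ substitute u').
  split; first by rewrite -catA.
  rewrite -cats1 -catA bcd_val_cat actM yE y'1 !act_bcd1 act_bcd0 /twist.
  rewrite act_a act_kval f1 /= actaK act_a scons_ones.
  by rewrite act_kval_ones.
exists (substitute u), f, (g :: r ++ substitute u'); split=> //.
rewrite -cats1 bcd_val_cat actM yE (negbTE y'0) act_bcd1 act_bcd0 /twist.
by rewrite actaK act_a scons_ones act_kval_ones.
Qed.

Lemma twist_inj y y' xi xi' : twist y xi = twist y' xi' -> y = y' /\ xi = xi'.
Proof.
move=> /scons_inj[<- e]; split=> //; case: y e => //.
exact: (can_inj actaK).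
Qed.

Definition subst_word (k : nat) : seq bcd := iter k substitute [:: Xb].

(** The image of a word visits two twisted copies, one behind each letter, of
    the points that the word visits. *)
Lemma subst_word_visited k : exists s : seq (nat -> bool),
  [/\ uniq s, size s = (2 ^ k)%N & forall xi, xi \in s -> visited (subst_word k) xi].
Proof.
elim: k => [|k [s [us ss sv]]].
  exists [:: point_act all_ones ga]; split=> // xi; rewrite mem_seq1 => /eqP->.
  exists [::], Xb, [::]; split=> //.
  by rewrite act_bcd1 act_bcd0 actaK act_kval_ones.
exists (map (twist true) s ++ map (twist false) s).
split; last 1 first.
- move=> xi; rewrite mem_cat => /orP[]/mapP[z /sv zv ->];
    exact: visited_subst zv.
- rewrite cat_uniq !map_inj_uniq ?us; try by move=> ? ? /twist_inj[].
  rewrite andbT /=; apply/hasPn => _ /mapP[z _ ->]; apply/mapP.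
  by move=> [z' _ /twist_inj[]].
- by rewrite size_cat !size_map ss expnS mul2n addnn.
Qed.

Lemma subst_word_prefix k : exists r, subst_word k.+1 = subst_word k ++ r.
Proof.
elim: k => [|k [r e]]; first by exists [:: Xd; Xc].
by exists (substitute r); rewrite -[LHS]/(substitute (subst_word k.+1)) {1}e subst_cat.
Qed.

Lemma subst_word_prefix_le k l : (k <= l)%N ->
  exists r, subst_word l = subst_word k ++ r.
Proof.
move=> /subnK<-; elim: (l - k)%N => [|m [r e]]; first by exists [::]; rewrite cats0.
have [r' ->] := subst_word_prefix (m + k); exists (r ++ r').
by rewrite e catA.
Qed.

Lemma size_subst_word k : (k < size (subst_word k))%N.
Proof.
have size_subst v : (2 * size v <= size (substitute v))%N.
  elim: v => // x v IH; rewrite -[substitute _]/(letter_subst x ++ substitute v) size_cat /=.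
  by case: x => /=; lia.
elim: k => // k IH; apply: leq_trans (size_subst (subst_word k)).
by move: (size _) IH => n; lia.
Qed.

(** The infinite fixed point [b d c c c b b ...] of the substitution. *)
Definition subst_limit (j : nat) : bcd := nth Xb (subst_word j) j.

Lemma mkseq_subst_limit k n : (n <= size (subst_word k))%N ->
  mkseq subst_limit n = take n (subst_word k).
Proof.
move=> nk; apply: (@eq_from_nth _ Xb) => [|i]; first by rewrite size_mkseq size_takel.
rewrite size_mkseq => ilt; rewrite nth_mkseq// nth_take// /subst_limit.
have [ik|ki] := leqP i k.
  by have [r ->] := subst_word_prefix_le ik; rewrite nth_cat size_subst_word.
have [r ->] := subst_word_prefix_le (ltnW ki).
by rewrite nth_cat (leq_trans ilt nk).
Qed.

Definition limit_val (n : nat) : grigorchuk := bcd_val (mkseq subst_limit n).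

Definition limit_point (n : nat) : nat -> bool := point_act all_ones (limit_val n)^-1%g.

Lemma limit_points k : exists s : seq (nat -> bool),
  [/\ uniq s, size s = (2 ^ k)%N &
      {subset s <= mkseq limit_point (size (subst_word k)).+1}].
Proof.
have [s [us ss sv]] := subst_word_visited k; exists s; split=> // xi.
move=> /sv[u [x [u' [kE xi1]]]]; apply/mapP; exists (size u).+1.
  rewrite mem_iota add0n ltnS kE size_cat /=; lia.
rewrite /limit_point /limit_val (@mkseq_subst_limit k); last first.
  by rewrite kE size_cat /=; lia.
rewrite kE -cat_rcons -(size_rcons u x) take_size_cat// -xi1.
by rewrite actK.
Qed.

(** * A path visiting many points of the orbit *)

(** [t i] is the time of the [i]-th visit to a point not visited before. *)
Lemma first_visits (X : eqType) (p : nat -> X) (N : nat -> nat) :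
    (forall k, exists s, [/\ uniq s, size s = (2 ^ k)%N &
       {subset s <= mkseq p (N k).+1}]) ->
  exists t : nat -> nat, [/\ t 0%N = 0%N, forall i, (t i < t i.+1)%N,
    injective (p \o t) & forall k, (t (2 ^ k).-1 <= N k)%N].
Proof.
move=> many; pose new i := p i \notin mkseq p i.
pose cnt n := count new (iota 0 n).
have cntS n : cnt n.+1 = (cnt n + new n)%N.
  by rewrite /cnt -addn1 iotaD count_cat /= addn0.
have mkseqS n : mkseq p n.+1 = rcons (mkseq p n) (p n).
  by rewrite /mkseq -addn1 iotaD map_cat cats1.
have cnt_ge n s : uniq s -> {subset s <= mkseq p n} -> (size s <= cnt n)%N.
  elim: n s => [|n IH] s us sn; first by case: s us sn => // x s _ /(_ x (mem_head _ _)).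
  rewrite cntS; have [/andP[ps newn]|] := boolP ((p n \in s) && new n).
    rewrite newn addn1 -(prednK (n := size s)); last by case: (s) ps.
    rewrite ltnS -(size_rem ps) IH ?rem_uniq// => x; rewrite mem_rem_uniq// inE.
    by move=> /andP[/negPf xn /sn]; rewrite mkseqS mem_rcons inE xn.
  rewrite negb_and => old; apply: leq_trans (leq_addr _ _); apply: IH => // x xs.
  have := sn x xs; rewrite mkseqS mem_rcons inE => /orP[/eqP xE|//].
  by move: old; rewrite -xE xs /= /new -xE negbK.
have unbounded i : exists n, (i < cnt n.+1)%N.
  have [s [us ss /(cnt_ge _ _ us)]] := many i; rewrite ss => le.
  by exists (N i); apply: leq_trans le; exact: ltn_expl.
pose t i := ex_minn (unbounded i).
have tP i : cnt (t i) = i /\ new (t i).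
  rewrite /t; case: ex_minnP => n ltin minn.
  have le_i : (cnt n <= i)%N.
    by case: n minn {ltin} => // n minn; rewrite leqNgt; apply/negP => /minn; rewrite ltnn.
  by move: ltin; rewrite cntS; case: (new n); split=> //; lia.
have cnt_mono m n : (m <= n)%N -> (cnt m <= cnt n)%N.
  move=> /subnK<-; elim: (n - m)%N => // k; rewrite addSn cntS => /leq_trans-> //.
  exact: leq_addr.
have t_lt i j : (i < j)%N -> (t i < t j)%N.
  move=> ij; rewrite ltnNge; apply/negP => /cnt_mono.
  by rewrite !(proj1 (tP _)) leqNgt ij.
have t_sep i j : (i < j)%N -> p (t i) != p (t j).
  move=> /t_lt tij; apply: contraTneq (proj2 (tP j)) => ptij.
  by rewrite /new -ptij negbK; apply/mapP; exists (t i); rewrite // mem_iota.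
exists t; split.
- by rewrite /t; case: ex_minnP => n _ /(_ 0%N); rewrite leqn0 => /(_ isT)/eqP.
- by move=> i; exact: t_lt.
- move=> i j /= ptij; case: (ltngtP i j) => // /t_sep; first by rewrite ptij eqxx.
  by rewrite ptij eqxx.
- move=> k; rewrite {1}/t; case: ex_minnP => n _; apply.
  have [s [us ss /(cnt_ge _ _ us)]] := many k; rewrite ss.
  by case: (2 ^ k)%N (expn_gt0 2 k).
Qed.

Section ShortWords.
Variable G : groupType.
Local Open Scope group_scope.
Definition word_prod (w : seq G) : G := \prod_(g <- w) g.

Lemma word_prod_cat u v : word_prod (u ++ v) = word_prod u * word_prod v.
Proof. exact: big_cat. Qed.

Lemma loop_erasure (w : seq G) : exists w' : seq G,
  [/\ {subset w' <= w}, word_prod w' = word_prod w, (size w' <= size w)%N &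
    forall i j, (i < j <= size w')%N ->
      word_prod (take i w') <> word_prod (take j w')].
Proof.
have [n] := ubnP (size w); elim: n w => // n IH w wn.
have [simple|] := pselect (forall i j, (i < j <= size w)%N ->
      word_prod (take i w) <> word_prod (take j w)); first by exists w; split.
move=> /existsNP[i /existsNP[j /not_implyP[/andP[ij jw] /contrapT eij]]].
have sz : size (take i w ++ drop j w) = (size w - (j - i))%N.
  by rewrite size_cat size_takel ?size_drop; lia.
have [|w' [w'w pw' sw' simple]] := IH (take i w ++ drop j w); first by rewrite sz; lia.
exists w'; split=> //.
- by move=> g /w'w; rewrite mem_cat => /orP[/mem_take|/mem_drop].
- by rewrite pw' word_prod_cat eij -word_prod_cat cat_take_drop.
- by rewrite (leq_trans sw')// sz leq_subr.
Qed.

End ShortWords.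

Definition bcd_gens (v : seq bcd) : seq grigorchuk :=
  flatten [seq [:: ga; kval (bcd_klein x)] | x <- v].

Lemma bcd_gens_prod v : word_prod (bcd_gens v) = bcd_val v.
Proof.
elim: v => [|x v IH]; first by rewrite /word_prod /bcd_val !big_nil.
rewrite -[bcd_gens _]/([:: ga; kval (bcd_klein x)] ++ bcd_gens v).
by rewrite word_prod_cat IH /word_prod /bcd_val !big_cons big_nil mulg1.
Qed.

Lemma size_bcd_gens v : size (bcd_gens v) = (2 * size v)%N.
Proof. by elim: v => //= x v ->; rewrite mulnS. Qed.

Lemma bcd_gensP v g : g \in bcd_gens v -> grigorchuk_gens g.
Proof.
elim: v => // x v IH; rewrite -[bcd_gens _]/([:: ga; kval (bcd_klein x)] ++ bcd_gens v).
rewrite mem_cat !inE => /orP[/orP[/eqP->|/eqP->]|/IH//]; first by constructor 1.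
by case: x; [constructor 2|constructor 3|constructor 4].
Qed.

(** The stops [q i] are the first visits along the infinite word.  Loops are
    erased between the stops so that the tree built on this path embeds. *)
Lemma lamp_path : exists (q : nat -> grigorchuk) (w : nat -> seq grigorchuk),
  [/\ q 0%N = 1%g, injective (fun i => orb_act orb0 (q i)^-1%g),
      forall i, [/\ q i.+1 = (q i * word_prod (w i))%g,
        forall g, g \in w i -> grigorchuk_gens g &
        forall j k, (j < k <= size (w i))%N ->
          word_prod (take j (w i)) <> word_prod (take k (w i))] &
      forall k, (\sum_(i < (2 ^ k).-1) size (w i) <= 2 * size (subst_word k))%N].
Proof.
have [t [t0 tS tinj tN]] := first_visits limit_points.
have step i : exists v, limit_val (t i.+1) = (limit_val (t i) * bcd_val v)%g /\
    size v = (t i.+1 - t i)%N.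
  exists (drop (t i) (mkseq subst_limit (t i.+1))); split; last first.
    by rewrite size_drop size_mkseq.
  rewrite /limit_val -bcd_val_cat -{1}(cat_take_drop (t i) (mkseq _ (t i.+1))).
  congr (bcd_val (_ ++ _)); rewrite /mkseq -map_take take_iota.
  by congr (map _ (iota _ _)); apply/minn_idPl/ltnW.
have /choice[w wP] : forall i, exists w : seq grigorchuk,
  [/\ limit_val (t i.+1) = (limit_val (t i) * word_prod w)%g,
      forall g, g \in w -> grigorchuk_gens g,
      forall j k, (j < k <= size w)%N ->
        word_prod (take j w) <> word_prod (take k w) &
      (size w <= 2 * (t i.+1 - t i))%N].
  move=> i; have [v [vE sv]] := step i.
  have [w [wv wE sw simple]] := loop_erasure (bcd_gens v).
  exists w; split=> // [|g /wv/bcd_gensP//|]; last by rewrite -sv -size_bcd_gens.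
  by rewrite wE bcd_gens_prod.
exists (fun i => limit_val (t i)), w; split.
- by rewrite t0 /limit_val /bcd_val big_nil.
- by move=> i j /(congr1 val) /= ij; apply: tinj.
- by move=> i; have [] := wP i.
move=> k; apply: (@leq_trans (2 * t (2 ^ k).-1)%N); last by rewrite leq_mul2l tN orbT.
elim: (2 ^ k).-1 => [|m IH]; first by rewrite big_ord0.
rewrite big_ord_recr /=; have [_ _ _ wm] := wP m.
apply: leq_trans (leq_add IH wm) _; have := tS m; lia.
Qed.

Section SubstWeight.
Variables (R : realType) (eta : R).
Local Open Scope ring_scope.
Hypothesis eta01 : 0 < eta < 1.
Hypothesis etaE : eta ^+ 3 + eta ^+ 2 + eta = 2.

(** The weights of the words [a x], namely 1 for [b], [eta] for [c] and
    [eta ^ 2] for [d], form a left eigenvector of the substitution matrix for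
    the eigenvalue [2 / eta]. *)
Lemma size_subst_word_le k :
  (size (subst_word k))%:R <= (eta ^+ 2)^-1 * (2 / eta) ^+ k.
Proof.
have /andP[e0 e1] := eta01.
pose weight x := match x with Xb => 1 | Xc => eta | Xd => eta ^+ 2 end.
pose total v := \sum_(x <- v) weight x.
have total_subst v : total (substitute v) = 2 / eta * total v.
  elim: v => [|x v IH]; first by rewrite /total !big_nil mulr0.
  rewrite -[substitute _]/(letter_subst x ++ substitute v) /total big_cat big_cons mulrDr.
  rewrite -/(total v) -IH; congr (_ + _).
  have ne : eta != 0 by rewrite gt_eqF.
  case: x; rewrite /= !big_cons big_nil /=.
  - by rewrite -etaE; field.
  - by field.
  - by field.
have totalE : total (subst_word k) = (2 / eta) ^+ k.
  elim: k => [|k IH]; first by rewrite /total big_seq1.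
  by rewrite -[subst_word _]/(substitute (subst_word k)) total_subst IH exprS.
rewrite -totalE mulrC ler_pdivlMr ?exprn_gt0//.
elim: (subst_word k) => [|x v IH]; first by rewrite /total big_nil mul0r.
rewrite /total big_cons /= -natr1 mulrDl mul1r addrC lerD//.
case: x => /=.
- by rewrite exprn_ile1// ltW.
- by rewrite expr2 ler_piMl// ltW.
- by [].
Qed.

End SubstWeight.

(** * The tree of lamp configurations along the path *)

Section LampTree.
Variables (A : finGroupType) (SA : {set A}) (s1 s2 : A).
Hypotheses (s1S : s1 \in SA) (s2S : s2 \in SA) (s12 : s1 != s2).
Hypotheses (SA1 : (1%g : A) \notin SA)
  (SAV : forall s : A, s \in SA -> (s^-1)%g \in SA).
Variables (q : nat -> grigorchuk) (w : nat -> seq grigorchuk).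
Hypotheses (q0 : q 0%N = 1%g)
  (q_sep : injective (fun i => orb_act orb0 (q i)^-1%g))
  (qw : forall i, q i.+1 = (q i * word_prod (w i))%g)
  (w_gens : forall i g, g \in w i -> grigorchuk_gens g)
  (w_simple : forall i j k, (j < k <= size (w i))%N ->
     word_prod (take j (w i)) <> word_prod (take k (w i))).
Local Notation W := (grig_wreath A).
Local Notation S := (grig_wreath_gens SA).
Local Open Scope group_scope.

(** The walker's state: the number of lamps met so far, and the letters to be
    read before the next lamp. *)
Definition walk_next (st : nat * seq grigorchuk) : nat * seq grigorchuk :=
  if st.2 is g :: r then (st.1, r) else (st.1.+1, w st.1).

Definition walk_state (n : nat) := iter n walk_next (0%N, [::]).

Definition lamp_step n : bool := nilp (walk_state n).2.

Definition walk_letter n : grigorchuk := head 1 (walk_state n).2.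

Fixpoint walk_top n : grigorchuk :=
  if n is m.+1 then walk_top m * walk_letter m else 1.

Lemma walk_stateS n : walk_state n.+1 = walk_next (walk_state n).
Proof. by []. Qed.

Lemma branchings_walk n : branchings lamp_step n = (walk_state n).1.
Proof.
elim: n => // n IH; rewrite branchingsS IH walk_stateS /walk_next /lamp_step.
by case: (walk_state n).2 => [|g r] /=; rewrite ?addn1 ?addn0.
Qed.

Lemma walk_top_q n :
  walk_top n * word_prod (walk_state n).2 = q (walk_state n).1.
Proof.
elim: n => [|n]; first by rewrite /word_prod big_nil mulg1 /= q0.
rewrite walk_stateS /walk_next /= /walk_letter.
case: (walk_state n) => i [|g r] /= IH.
  by rewrite qw -IH /word_prod big_nil !mulg1.
by rewrite -IH /word_prod big_cons mulgA.
Qed.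

Lemma walk_state_suffix n : walk_state n = (0%N, [::]) \/
  exists i m, [/\ (walk_state n).1 = i.+1, (m <= size (w i))%N &
    (walk_state n).2 = drop m (w i)].
Proof.
elim: n => [|n IH]; [by left|right]; rewrite walk_stateS /walk_next.
case: IH => [->|[i [m [iE mw rE]]]]; first by exists 0%N, 0%N; rewrite drop0.
case dE : (walk_state n).2 => [|g r] /=.
  by exists (walk_state n).1, 0%N; rewrite drop0.
exists i, m.+1; split=> //; rewrite rE in dE.
  by rewrite ltnNge; apply/negP => /drop_oversize e; rewrite e in dE.
by rewrite -addn1 addnC -drop_drop dE drop1.
Qed.

Lemma walk_state_mono n k : ((walk_state n).1 <= (walk_state (n + k)).1)%N.
Proof.
elim: k => [|k IH]; first by rewrite addn0.
rewrite addnS walk_stateS /walk_next; apply: leq_trans IH _.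
by case: (walk_state (n + k)).2.
Qed.

Lemma walk_state_drop n k : (walk_state (n + k)).1 = (walk_state n).1 ->
  (k <= size (walk_state n).2)%N /\
  (walk_state (n + k)).2 = drop k (walk_state n).2.
Proof.
elim: k => [|k IH]; first by rewrite addn0 drop0.
rewrite addnS walk_stateS /walk_next => stE.
have e : (walk_state (n + k)).1 = (walk_state n).1.
  apply/eqP; rewrite eqn_leq walk_state_mono andbT -stE.
  by case: (walk_state (n + k)).2.
have [kr rE] := IH e; move: stE; rewrite rE.
case dE : (drop k _) => [|g r] /= stE; first by move: stE; rewrite e; lia.
split; last by rewrite -addn1 addnC -drop_drop dE drop1.
by rewrite ltnNge; apply/negP => /drop_oversize e'; rewrite e' in dE.
Qed.

Definition lamp_stop m : nat := \sum_(i < m) (size (w i)).+1.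

Lemma walk_state_stop m : walk_state (lamp_stop m) = (m, [::]).
Proof.
elim: m => [|m IH]; first by rewrite /lamp_stop big_ord0.
rewrite /lamp_stop big_ord_recr /= -/(lamp_stop m) addnS /walk_state.
rewrite -addSn addnC iterD iterS -/(walk_state _) IH /walk_next /=.
by elim: (w m) => // g r IHr; rewrite [size _]/= iterSr.
Qed.

Lemma branchings_ge m n :
  (lamp_stop m <= n)%N -> (m <= branchings lamp_step n)%N.
Proof.
move=> /subnKC <-; rewrite branchings_walk.
by apply: leq_trans (walk_state_mono _ _); rewrite walk_state_stop.
Qed.

Definition step_elt n (b : bool) : W :=
  if lamp_step n then wr_base orb_action orb0 (if b then s1 else s2)
  else wr_lift A orb_action (walk_letter n).

Definition lamp_label (d : seq bool) : W :=
  \prod_(i < size d) step_elt i (nth false d i).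

Lemma lamp_label_rcons d b :
  lamp_label (rcons d b) = lamp_label d * step_elt (size d) b.
Proof.
rewrite /lamp_label size_rcons big_ord_recr /= nth_rcons ltnn eqxx.
by congr (_ * _); apply: eq_bigr => i _; rewrite nth_rcons ltn_ord.
Qed.

Lemma step_elt_top n b : wr_top (step_elt n b) = walk_letter n.
Proof.
rewrite /step_elt /lamp_step /walk_letter.
by case: (walk_state n).2.
Qed.

Lemma lamp_label_top d : wr_top (lamp_label d) = walk_top (size d).
Proof.
elim/last_ind: d => [|d b IH]; first by rewrite /lamp_label big_ord0.
by rewrite lamp_label_rcons size_rcons /= IH step_elt_top.
Qed.

Definition lamp_point i : orbX := orb_act orb0 (q i)^-1.

(** The lamps, in coordinates in which the walk does not move them. *)
Definition lamp_at (d : seq bool) (x : orbX) : A :=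
  wr_fun (lamp_label d) (orb_act x (walk_top (size d))).

Lemma lamp_at_rcons d b x : lamp_at (rcons d b) x =
  lamp_at d x *
  (if lamp_step (size d) && (x == lamp_point (branchings lamp_step (size d)))
   then if b then s1 else s2 else 1).
Proof.
rewrite /lamp_at lamp_label_rcons size_rcons /= step_elt_top.
set n := size d; congr (wr_fun _ _ * _).
  rewrite orb_actM; exact: (ractK orb_action).
rewrite /step_elt; have [ln|//] := boolP (lamp_step n); rewrite /=.
suff -> : (orb_act x (walk_top n * walk_letter n) == orb0) =
  (x == lamp_point (branchings lamp_step n)) by [].
rewrite /lamp_point; have <- : walk_top n = q (branchings lamp_step n).
  rewrite branchings_walk -walk_top_q; move: ln; rewrite /lamp_step.
  by move=> /nilP->; rewrite /word_prod big_nil mulg1.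
rewrite /walk_letter; move: ln => /nilP->; rewrite /= mulg1.
apply/eqP/eqP => [<-|->].
  by apply/esym; exact: (ractK orb_action).
exact: (ractVK orb_action).
Qed.

Lemma lamp_point_inj : injective lamp_point.
Proof. exact: q_sep. Qed.

Lemma lamp_at_unlit d i : (branchings lamp_step (size d) <= i)%N ->
  lamp_at d (lamp_point i) = 1.
Proof.
elim/last_ind: d => [|d b IH]; first by rewrite /lamp_at /lamp_label big_ord0.
rewrite size_rcons branchingsS => le; rewrite lamp_at_rcons IH; last by lia.
rewrite (inj_eq lamp_point_inj); case: ifP => [/andP[ln /eqP ie]|_]; last by rewrite mulg1.
by move: le; rewrite ln ie; lia.
Qed.

Lemma lamp_at_lit d i : (i < branchings lamp_step (size d))%N ->
  lamp_at d (lamp_point i) != 1.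
Proof.
elim/last_ind: d => [|d b IH]; first by rewrite branchings_walk.
rewrite size_rcons branchingsS lamp_at_rcons (inj_eq lamp_point_inj) => lt.
have [ie|ine] := eqVneq i (branchings lamp_step (size d)).
  move: lt; rewrite -ie; case: (lamp_step _) => /= lt; last by lia.
  rewrite lamp_at_unlit ?ie// mul1g.
  by apply: contraNneq SA1 => <-; case: b.
rewrite andbF mulg1; apply: IH; move: lt ine.
by case: (lamp_step _) => /= lt /eqP; lia.
Qed.

Lemma lamp_label_branchings d d' : lamp_label d = lamp_label d' ->
  (branchings lamp_step (size d') <= branchings lamp_step (size d))%N.
Proof.
move=> dd'; rewrite leqNgt; apply/negP => lt.
have := lamp_at_lit lt; rewrite -(lamp_at_unlit (leqnn (branchings _ (size d)))).
by rewrite /lamp_at -!lamp_label_top dd' eqxx.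
Qed.

(** The number of lit lamps tells on which segment between two stops the walk
    is, and segments have no loops. *)
Lemma lamp_label_size d d' : lamp_label d = lamp_label d' -> size d = size d'.
Proof.
wlog dd' : d d' / (size d <= size d')%N => [hw|] e.
  by have [/hw->|/ltnW/hw->] := leqP (size d) (size d').
have {e}[tE bE] : walk_top (size d) = walk_top (size d') /\
    (walk_state (size d')).1 = (walk_state (size d)).1.
  split; first by rewrite -!lamp_label_top e.
  rewrite -!branchings_walk; apply/eqP.
  by rewrite eqn_leq (lamp_label_branchings e) (lamp_label_branchings (esym e)).
move: bE tE; rewrite -(subnKC dd'); move: (size d) (_ - _)%N => n k bE tE.
have [kr rE] := walk_state_drop bE.
have := walk_top_q n; rewrite -bE -walk_top_q -tE rE => /mulgI.
have [st0|[i [m [_ mw stE]]]] := walk_state_suffix n.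
  by move: kr; rewrite st0 leqn0 => /eqP->; rewrite addn0.
rewrite stE drop_drop => pE; case: k bE tE kr rE pE => [|k] bE tE kr rE pE.
  by rewrite addn0.
case: (w_simple (i := i) (j := m) (k := k.+1 + m)).
  by rewrite stE size_drop in kr; lia.
apply: (mulIg (word_prod (drop m (w i)))).
by rewrite -word_prod_cat cat_take_drop pE -word_prod_cat cat_take_drop.
Qed.

(** The lamp lit last tells the last choice. *)
Lemma lamp_label_inj d d' :
  admissible lamp_step d -> admissible lamp_step d' ->
  lamp_label d = lamp_label d' -> d = d'.
Proof.
move=> ad ad' e; have := lamp_label_size e.
elim/last_ind: d d' ad ad' e => [|d b IH] d'; first by move=> _ _ _ /esym/size0nil.
case/lastP: d' => [|d' b']; first by rewrite size_rcons.
rewrite !admissible_rcons !size_rcons => /andP[ad adb] /andP[ad' adb'] e [sz].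
have bb' : b = b'.
  move: adb adb'; rewrite -sz; have [ln _ _|] := boolP (lamp_step (size d)); last first.
    by move=> _; case: b b' {e} => [] [].
  have := erefl (lamp_at (rcons d b) (lamp_point (branchings lamp_step (size d)))).
  rewrite {2}/lamp_at -lamp_label_top e lamp_label_top -/(lamp_at _ _).
  rewrite !lamp_at_rcons -sz ln eqxx !lamp_at_unlit -?sz// !mul1g.
  by move: s12 => /eqP; case: b b' {e} => [] [] // ? /esym.
congr rcons => //; apply: IH => //; move: e.
by rewrite !lamp_label_rcons sz bb' => /mulIg.
Qed.

Lemma step_elt_gen n b : S (step_elt n b).
Proof.
rewrite /step_elt /lamp_step /walk_letter.
have [->|[i [m [_ _ ->]]]] := walk_state_suffix n.
  by left; exists (if b then s1 else s2) => //; case: b.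
case dE : (drop m (w i)) => [|g r] /=.
  by left; exists (if b then s1 else s2) => //; case: b.
right; exists g => //; apply: (w_gens (i := i)).
by apply: (mem_drop (n0 := m)); rewrite dE mem_head.
Qed.

Lemma lamp_label_products d : products S (size d) (lamp_label d).
Proof.
elim/last_ind: d => [|d b IH]; first by rewrite /lamp_label big_ord0.
rewrite size_rcons lamp_label_rcons; exists (lamp_label d), (step_elt (size d) b).
by split=> //; exact: step_elt_gen.
Qed.

Lemma wreath_gensV s : S s -> S s^-1.
Proof.
case=> [[a aS <-]|[g gS <-]].
  left; exists a^-1; first exact: SAV.
  apply: wreath_eqP => [x|] /=; last by rewrite invg1.
  by rewrite orb_act1; case: ifP; rewrite ?invg1.
right; exists g^-1; last by apply: wreath_eqP => [x|] //=; rewrite invg1.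
have inv f : involutive (taut_fun f) -> f^-1 = f.
  move=> ff; apply: (mulIg f); rewrite mulVg; apply/esym.
  by apply: taut_eqP => u; exact: ff.
move: gS; rewrite /grigorchuk_gens /= => -[] ->.
- by constructor 1; exact/inv/grig_aK.
- by constructor 2; exact/inv/grig_bK.
- by constructor 3; exact/inv/grig_cK.
- by constructor 4; exact/inv/grig_dK.
Qed.

Definition lamp_tree : rooted_tree W := coded_tree lamp_label_inj.

Lemma lamp_tree_subgraph : rooted_subtree_of lamp_tree (cayley S) 1.
Proof.
split=> [|u v /=]; first by rewrite /= /lamp_label big_ord0.
case/orP=> /asboolP[d [b [_ -> ->]]]; apply/asboolP.
  exists (step_elt (size d) b); first exact: step_elt_gen.
  exact: lamp_label_rcons.
exists (step_elt (size d) b)^-1; first exact/wreath_gensV/step_elt_gen.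
by rewrite lamp_label_rcons mulgK.
Qed.

End LampTree.

(** * From powers to exponents *)

Local Open Scope ring_scope.

(** A group generated by a single involution has only two elements. *)
Lemma generators_pair (A : finGroupType) (SA : {set A}) :
    (3 <= #|{: A}|)%N -> (forall s : A, s \in <<SA>>%g) ->
    (forall s : A, s \in SA -> (s^-1)%g \in SA) ->
  exists s1 s2, [/\ s1 \in SA, s2 \in SA & s1 != s2].
Proof.
move=> A3 Agen SAV; have [/card_gt1P[s1 [s2 [? ? ?]]]|] := ltnP 1 #|SA|.
  by exists s1, s2.
have cardA : (#|{: A}| <= #|<<SA>>%g|)%N.
  by rewrite -cardsT; apply/subset_leq_card/fintype.subsetP.
rewrite leq_eqVlt ltnS leqn0 cards_eq0 => /orP[/cards1P[s sE]|/eqP S0].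
  have : (s^-1)%g \in SA by apply: SAV; rewrite sE inE.
  rewrite sE inE => /eqP sV; have : (#[s]%g <= 2)%N.
    by rewrite dvdn_leq// order_dvdn expgS expg1 -{1}sV mulVg.
  by rewrite /order /cycle -sE; lia.
by move: cardA; rewrite S0 gen0 cards1; lia.
Qed.

Section PowerAsymptotics.
Variable R : realType.

Lemma powR_unbounded (gam M : R) : 0 < gam ->
  exists N, forall n, (N <= n)%N -> M <= n%:R `^ gam.
Proof.
move=> g0; pose x := Num.max 1 M; have x1 : 1 <= x by rewrite le_max lexx.
have x0 : 0 <= x by apply: le_trans x1.
exists (Num.bound (x `^ gam^-1)) => n Nn.
have : x `^ gam^-1 <= n%:R.
  apply: le_trans (ltW (archi_boundP _)) _; first exact: powR_ge0.
  by rewrite ler_nat.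
move=> /(ge0_ler_powR (ltW g0)); rewrite !nnegrE powR_ge0 ler0n => /(_ isT isT).
by rewrite -powRrM mulVf ?gt_eqF// powRr1//; apply: le_trans; rewrite le_max lexx orbT.
Qed.

Variable lam : R.
Hypothesis lam2 : 2 <= lam.
Let alpha : R := ln 2 / ln lam.

Lemma ln_lam_gt0 : 0 < ln lam.
Proof. by rewrite ln_gt0//; apply: lt_le_trans lam2; rewrite ltr1n. Qed.

Lemma alpha_gt0 : 0 < alpha.
Proof. by rewrite divr_gt0 ?ln_lam_gt0// ln_gt0// ltr1n. Qed.

Lemma lam_expr_powR k : (lam ^+ k) `^ alpha = 2 ^+ k.
Proof.
have lam0 : 0 < lam by apply: lt_le_trans lam2.
rewrite -powR_mulrn ?ltW// -powRrM mulrC powRrM powR_mulrn ?powR_ge0//.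
congr (_ ^+ k); rewrite /powR gt_eqF// divfK ?gt_eqF ?ln_lam_gt0//.
by rewrite lnK// posrE.
Qed.

Lemma expr_scale (x : R) : 1 <= x -> exists k, lam ^+ k <= x <= lam ^+ k.+1.
Proof.
move=> x1; have [k xk] : exists k, x <= lam ^+ k.
  exists (Num.bound x); have x0 : 0 <= x by apply: le_trans x1.
  apply: le_trans (ltW (archi_boundP x0)) _.
  apply: (@le_trans _ _ (2 ^+ Num.bound x)); last first.
    by rewrite lerXn2r// nnegrE// (le_trans _ lam2).
  by rewrite -natrX ler_nat ltnW// ltn_expl.
elim: k xk => [|k IH] xk.
  exists 0%N; rewrite expr0 expr1 x1 /=; apply: le_trans xk _.
  by rewrite expr0; apply: le_trans lam2; rewrite ler1n.
by have [/IH//|/ltW kx] := leP x (lam ^+ k); exists k; rewrite kx.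
Qed.

(** Scales of lengths: the powers of [lam] become powers of 2 once raised to
    the exponent [alpha]. *)
Lemma powR_scale (x : R) : 1 <= x ->
  exists k, lam ^+ k <= x <= lam ^+ k.+1 /\ 2 ^+ k <= x `^ alpha <= 2 ^+ k.+1.
Proof.
move=> x1; have [k /andP[kx xk]] := expr_scale x1; exists k; rewrite kx xk; split=> //.
have lam0 n : 0 <= lam ^+ n by rewrite exprn_ge0// (le_trans _ lam2).
have x0 : 0 <= x by apply: le_trans x1.
by rewrite -!lam_expr_powR !ge0_ler_powR ?nnegrE// ltW// alpha_gt0.
Qed.

Lemma upper_powR (b : nat -> nat) (Q : nat) :
    (forall n k, n%:R <= lam ^+ k -> (b n <= Q ^ (2 ^ k))%N) ->
  exists2 C, 0 < C & forall n, (0 < n)%N -> (b n)%:R <= expR (C * n%:R `^ alpha).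
Proof.
move=> bQ; have lnQ : 0 <= ln (Q.+1%:R : R) by rewrite ln_ge0// ler1n.
exists (2 * ln (Q.+1%:R) + 1) => [|n n0]; first by rewrite ltr_wpDl// mulr_ge0.
have n1 : 1 <= n%:R :> R by rewrite ler1n.
have [k [/andP[_ nk] /andP[kn _]]] := powR_scale n1.
apply: (@le_trans _ _ ((Q.+1 ^ (2 ^ k.+1))%N%:R)).
  by rewrite ler_nat (leq_trans (bQ _ _ nk))// leq_exp2r// expn_gt0.
have Q0 : (0 : R) < Q.+1%:R by rewrite ltr0n.
rewrite natrX -[X in X ^+ _](lnK (x := Q.+1%:R)) ?posrE// -expRM_natl ler_expR.
rewrite expnS natrM natrX.
have := ler_wpM2r lnQ kn; have := powR_ge0 (n%:R : R) alpha; lra.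
Qed.

Lemma lower_powR (br : nat -> nat) (K : R) :
    (forall n k, K * lam ^+ k <= n%:R -> (2 ^ k <= (br n).+1)%N) ->
  exists2 c, 0 < c & forall n, c * n%:R `^ alpha <= (br n).+1%:R.
Proof.
move=> brK; pose K' := Num.max 1 K; have K1 : 1 <= K' by rewrite le_max lexx.
have K0 : 0 < K' by apply: lt_le_trans K1.
have Ka0 : 0 < K' `^ alpha by rewrite powR_gt0.
exists (2 * K' `^ alpha)^-1 => [|n]; first by rewrite invr_gt0 mulr_gt0.
rewrite mulrC ler_pdivrMr ?mulr_gt0//.
have a0 := ltW alpha_gt0.
have [nK|Kn] := ltP (n%:R : R) K'.
  apply: (@le_trans _ _ (K' `^ alpha)).
    by apply: ge0_ler_powR; rewrite ?nnegrE ?ler0n//; exact: ltW.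
  by rewrite mulrA -[leLHS]mul1r ler_pM2r// -natrM ler1n muln_gt0.
have x1 : 1 <= n%:R / K' by rewrite ler_pdivlMr// mul1r.
have [k [/andP[kx _] /andP[_ xk]]] := powR_scale x1.
have nE : n%:R = n%:R / K' * K' by rewrite divfK// gt_eqF.
rewrite nE powRM ?(ltW K0) ?(le_trans _ x1)//.
rewrite mulrA ler_pM2r//; apply: le_trans xk _; rewrite exprS mulrC ler_pM2r//.
rewrite -natrX ler_nat; apply: brK; rewrite nE [leRHS]mulrC.
apply: (@le_trans _ _ (K' * lam ^+ k)); last by rewrite ler_pM2l.
by rewrite ler_wpM2r ?exprn_ge0 ?(le_trans _ lam2)// le_max lexx orbT.
Qed.

(** [K] is chosen large enough for the lower bound on the ball of radius
    [K.+1 * n] to beat the upper bound on the ball of radius [n]. *)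
Lemma sphere_powR (b e br : nat -> nat) (C c : R) : 0 < C -> 0 < c ->
    (forall n K, (b (K.+1 * n)%N <= (e n).+1 ^ K * b n)%N) ->
    (forall n, (0 < n)%N -> (b n)%:R <= expR (C * n%:R `^ alpha)) ->
    (forall n, c * n%:R `^ alpha <= (br n).+1%:R) ->
    (forall n, (2 ^ br n <= b n)%N) ->
  exists2 del, 0 < del & forall n, (0 < n)%N ->
    expR (del * n%:R `^ alpha) <= (e n).+1%:R.
Proof.
move=> C0 c0 be bC brc brb.
have l20 : 0 < ln 2 :> R by rewrite ln_gt0// ltr1n.
have [N NP] := powR_unbounded ((C + ln 2 + 1) / (c * ln 2)) alpha_gt0.
pose K := N.+1; exists K%:R^-1 => [|n n0]; first by rewrite invr_gt0 ltr0n.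
have K0 : (0 : R) < K%:R by rewrite ltr0n.
have na1 : 1 <= (n%:R : R) `^ alpha.
  apply: (@le_trans _ _ (1 `^ alpha)); first by rewrite powR1.
  apply: ge0_ler_powR; rewrite ?nnegrE ?ler0n ?ler1n//.
  by rewrite ltW// alpha_gt0.
have := be n K; rewrite -(ler_nat R) natrM natrX => bound.
have e0 : (0 : R) < (e n).+1%:R by rewrite ltr0n.
have E : 2 ^+ br (K.+1 * n)%N <= (e n).+1%:R ^+ K * expR (C * n%:R `^ alpha).
  rewrite -natrX; apply: le_trans (le_trans bound _); first by rewrite ler_nat.
  by rewrite ler_pM2l ?exprn_gt0// bC.
have : (br (K.+1 * n)%N)%:R * ln 2 <=
    K%:R * ln ((e n).+1%:R : R) + C * n%:R `^ alpha.
  rewrite !mulr_natl -!lnXn// -[C * _]expRK -lnM ?posrE ?exprn_gt0 ?expR_gt0//.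
  by rewrite ler_ln ?posrE ?mulr_gt0 ?exprn_gt0 ?expR_gt0.
have := brc (K.+1 * n)%N; rewrite natrM powRM ?ler0n// -[leRHS]natr1.
have := NP K.+1; rewrite /K => /(_ (leqW (leqW (leqnn _)))).
rewrite ler_pdivrMr ?mulr_gt0// -/K => h1 h2 h3.
suff : K%:R^-1 * n%:R `^ alpha <= ln ((e n).+1%:R : R).
  by move=> h; rewrite -[leRHS]lnK ?posrE// ler_expR.
rewrite mulrC ler_pdivrMr// mulrC.
move: h1 h2 h3 na1; set x := K.+1%:R `^ alpha; set y := n%:R `^ alpha.

move=> h1 h2 h3 y1; have y0 : 0 <= y := le_trans ler01 y1.
have := ler_wpM2r y0 h1; have := ler_wpM2r (ltW l20) h2.
have := ler_wpM2r (ltW l20) y1; lra.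
Qed.

Lemma exponent_cvg (e : nat -> nat) (C del : R) : 0 < C -> 0 < del ->
    (forall n, (0 < n)%N -> (e n)%:R <= expR (C * n%:R `^ alpha)) ->
    (forall n, (0 < n)%N -> expR (del * n%:R `^ alpha) <= (e n).+1%:R) ->
  (ln (ln (e n)%:R) / ln n%:R : R) @[n --> \oo] --> alpha.
Proof.
move=> C0 d0 eC ed.
have l20 : 0 < ln 2 :> R by rewrite ln_gt0// ltr1n.
have [N NP] := powR_unbounded (2 * ln 2 / del) alpha_gt0.
pose B := `|ln C| + `|ln (del / 2)|.
have B0 : 0 <= B by rewrite addr_ge0.
have close n : (2 <= n)%N -> (N <= n)%N ->
    `|alpha - ln (ln (e n)%:R) / ln n%:R| <= B / ln (n%:R : R).
  move=> n2 Nn; have n0 : (0 < n)%N by apply: leq_trans n2.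
  have n0' : (0 : R) < n%:R by rewrite ltr0n.
  have ln0 : 0 < ln (n%:R : R) by rewrite ln_gt0// ltr1n.
  set y := (n%:R : R) `^ alpha.
  have y0 : 0 < y by rewrite powR_gt0.
  have lny : ln y = alpha * ln n%:R by rewrite ln_powR.
  have ey : 2 * ln 2 <= del * y.
    by have := NP n Nn; rewrite ler_pdivrMr// [_ * del]mulrC.
  have e1 : (0 < e n)%N.
    rewrite lt0n; apply/eqP => e0; have := ed n n0; rewrite e0 leNgt => /negP; apply.
    by rewrite -[ltLHS]expR0 ltr_expR mulr_gt0.
  have e0 : (0 : R) < (e n)%:R by rewrite ltr0n.
  have le_up : ln ((e n)%:R : R) <= C * y.
    by rewrite -[leRHS]expRK ler_ln ?posrE ?expR_gt0// eC.
  have le_low : del / 2 * y <= ln ((e n)%:R : R).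
    have : del * y <= ln (2 * (e n)%:R : R).
      rewrite -[leLHS]expRK ler_ln ?posrE ?expR_gt0 ?mulr_gt0//.
      apply: le_trans (ed n n0) _; rewrite -natrM ler_nat; lia.
    rewrite lnM ?posrE//; lra.
  have dy0 : 0 < del / 2 * y by rewrite mulr_gt0// divr_gt0.
  have le0 : 0 < ln ((e n)%:R : R) by apply: lt_le_trans le_low.
  have up : ln (ln (e n)%:R) <= ln C + alpha * ln (n%:R : R).
    by rewrite -lny -lnM ?posrE// ler_ln ?posrE ?mulr_gt0.
  have low : ln (del / 2) + alpha * ln (n%:R : R) <= ln (ln (e n)%:R).
    by rewrite -lny -lnM ?posrE ?divr_gt0// ler_ln ?posrE.
  have -> : alpha - ln (ln (e n)%:R) / ln n%:R =
      (alpha * ln n%:R - ln (ln (e n)%:R)) / ln n%:R.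
    by rewrite mulrBl mulfK// gt_eqF.
  rewrite normrM normfV (gtr0_norm ln0) ler_pM2r ?invr_gt0// /B.
  have := ler_norm (ln C); have := ler_norm (- ln C); rewrite normrN.
  have := ler_norm (ln (del / 2)); have := ler_norm (- ln (del / 2)); rewrite normrN.
  by rewrite ler_norml; lra.
apply/cvgrPdist_le => eps eps0.
have [M MP] : exists M, forall n, (M <= n)%N -> B / eps <= ln (n%:R : R).
  exists (Num.bound (expR (B / eps))) => n Mn.
  rewrite -[leLHS]expRK ler_ln ?posrE ?expR_gt0//.
    by apply: le_trans (ltW (archi_boundP (expR_ge0 _))) _; rewrite ler_nat.
  apply: lt_le_trans (expR_gt0 (B / eps)) _.
  apply: le_trans (ltW (archi_boundP (expR_ge0 _))) _.
  by rewrite ler_nat.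
exists (2 + N + M)%N => // n nge; have {}nge : (2 + N + M <= n)%N := nge.
have [n2 Nn Mn] : [/\ (2 <= n)%N, (N <= n)%N & (M <= n)%N] by split; lia.
apply: le_trans (close n n2 Nn) _.
have ln0 : 0 < ln (n%:R : R) by rewrite ln_gt0// ltr1n.
by rewrite ler_pdivrMr// mulrC -ler_pdivrMr// MP.
Qed.

(** Level [n] of the tree carries [2 ^ branchings br n] vertices, between which
    an even flow from the root is split. *)
Lemma cutset_inf_gt0 (T : choiceType) (br : nat -> bool) (label : seq bool -> T)
    (inj : forall d d', admissible br d -> admissible br d' ->
       label d = label d' -> d = d') (c l : R) :
    0 < c -> 0 < l < alpha ->
    (forall n, c * n%:R `^ alpha <= (branchings br n).+1%:R) ->
  (0 < cutset_inf (coded_tree inj) l)%E.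
Proof.
move=> c0 /andP[l0 la] brc.
have l20 : 0 < ln 2 :> R by rewrite ln_gt0// ltr1n.
have al0 : 0 < alpha - l by rewrite subr_gt0.
have [N NP] := powR_unbounded (c * ln 2)^-1 al0.
(* The factor 2 makes up for the [+ 1] in the bound on [branchings]. *)
pose kappa := expR (- (N%:R `^ l)) / 2.
have k0 : 0 < kappa by rewrite divr_gt0 ?expR_gt0.
apply: (@lt_le_trans _ _ kappa%:E); first by rewrite lte_fin.
apply: cutset_inf_ge => n; have [Nn|nN] := leqP N n; last first.
  apply: (@le_trans _ _ kappa).
    by rewrite ler_pdivrMr ?exprn_gt0// ler_peMr ?(ltW k0)// exprn_ege1// ler1n.
  apply: (@le_trans _ _ (expR (- (N%:R `^ l)))).
    by rewrite ler_pdivrMr// ler_peMr ?expR_ge0// ler1n.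
  rewrite ler_expR lerN2; apply: ge0_ler_powR; rewrite ?nnegrE ?ler0n ?ler_nat//.
    exact: ltW.
  exact: ltnW.
set b := branchings br n.
have nl : n%:R `^ l <= c * n%:R `^ alpha * ln 2.
  have [->|n0] := posnP n; first by rewrite !powR0 ?gt_eqF ?alpha_gt0//; lra.
  have n0' : (0 : R) < n%:R by rewrite ltr0n.
  have -> : alpha = (alpha - l) + l by rewrite subrK.
  rewrite powRD; last by rewrite (gt_eqF n0') implybT.
  have := NP n Nn; rewrite -[leLHS]div1r ler_pdivrMr ?mulr_gt0// => h.
  have := ler_wpM2r (powR_ge0 (n%:R : R) l) h; lra.
have nb : n%:R `^ l <= b%:R * ln 2 + ln 2.
  apply: le_trans nl _; rewrite -[X in _ + X]mul1r -mulrDl natr1.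
  by rewrite ler_wpM2r// ltW.
rewrite ler_pdivrMr ?exprn_gt0//.
have -> : 2 ^+ b = expR (b%:R * ln 2) :> R.
  by rewrite expRM_natl lnK ?posrE.
rewrite -expRD; apply: (@le_trans _ _ (expR (- ln 2))).
  by rewrite expRN lnK ?posrE// ler_pdivrMr// mulVf ?pnatr_eq0.
by rewrite ler_expR; lra.
Qed.

(** As [n ^ l] outgrows [n ^ alpha], the level cutsets have arbitrarily small
    sums. *)
Lemma cutset_inf_gt0_le (T : choiceType) (br : nat -> bool) (label : seq bool -> T)
    (inj : forall d d', admissible br d -> admissible br d' ->
       label d = label d' -> d = d') (B : nat -> set T) (C l : R) :
    (forall n, finite_set (B n)) ->
    (forall d, admissible br d -> B (size d) (label d)) ->
    (forall n, (0 < n)%N -> (#|` fset_set (B n)|)%:R <= expR (C * n%:R `^ alpha)) ->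
    (0 < cutset_inf (coded_tree inj) l)%E -> l <= alpha.
Proof.
move=> finB labB BC cut0; rewrite leNgt; apply/negP => la.
have la0 : 0 < l - alpha by rewrite subr_gt0.
have [N NP] := powR_unbounded (C + 1) la0.
have small M : 0 <= M -> (cutset_inf (coded_tree inj) l <= (expR (- M))%:E)%E.
  move=> M0; have [N' NP'] := powR_unbounded M alpha_gt0.
  pose n := (N + N').+1.
  have n0' : (0 : R) < n%:R by rewrite ltr0n.
  have h1 : C + 1 <= n%:R `^ (l - alpha) by apply: NP; rewrite /n; lia.
  have h2 : M <= n%:R `^ alpha by apply: NP'; rewrite /n; lia.
  have level d : admissible br d -> size d = n -> B n (label d).
    by move=> ad dn; have := labB d ad; rewrite dn.
  apply: le_trans (cutset_inf_le inj l (ltn0Sn _) (finB n) level) _.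
  rewrite lee_fin -[leLHS]mulr_natr.
  apply: le_trans (ler_wpM2l (expR_ge0 _) (BC n (ltn0Sn _))) _.
  rewrite -expRD ler_expR.
  have -> : n%:R `^ l = n%:R `^ (l - alpha) * n%:R `^ alpha.
    by rewrite -powRD ?subrK// (gt_eqF n0') implybT.
  have := ler_wpM2r (powR_ge0 (n%:R : R) alpha) h1; lra.
have := small 0 (lexx _); move: cut0 small; case: (cutset_inf _ l) => [r| |//].
  rewrite lte_fin => r0 small _.
  have [r1|r1] := leP 1 r.
    have := small 1 ler01; rewrite lee_fin leNgt => /negP; apply.
    by apply: lt_le_trans r1; rewrite -[ltRHS]expR0 ltr_expR; lra.
  have lnr : ln r <= 0 by rewrite ln_le0// ltW.
  have M0 : 0 <= 1 - ln r by lra.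
  have := small _ M0; rewrite lee_fin leNgt => /negP; apply.
  by rewrite -[ltRHS](lnK (x := r)) ?posrE// ltr_expR; lra.
by move=> _ _; rewrite leNgt ltry.
Qed.

End PowerAsymptotics.

(** * The two exponents *)

Lemma IBN_eq (T : choiceType) (t : rooted_tree T) (R : realType) (a : R) :
    0 < a -> (forall l, 0 < l < a -> (0 < cutset_inf t l)%E) ->
    (forall l, 0 < l -> (0 < cutset_inf t l)%E -> l <= a) ->
  IBN t R = a%:E.
Proof.
move=> a0 low up; apply/eqP; rewrite eq_le; apply/andP; split.
  apply/ereal_supP => _ [->|[l [l0 cl] <-]]; first by rewrite lee_fin ltW.
  by rewrite lee_fin up.
rewrite leNgt; apply/negP.
have : (0 <= IBN t R)%E by apply: ereal_sup_ubound; left.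
have : forall l, 0 < l < a -> (l%:E <= IBN t R)%E.
  move=> l la; apply: ereal_sup_ubound; right; exists l => //; split.
    by case/andP: la.
  exact: low.
case: (IBN t R) => [r| |//]; last by move=> _ _; rewrite ltNge leey.
move=> H; rewrite lee_fin lte_fin => r0 ra.
have : (((r + a) / 2)%:E <= r%:E)%E by apply: H; lra.
by rewrite lee_fin; lra.
Qed.

Lemma eta_root (R : realType) (eta : R) :
    root ('X^3 + 'X^2 + 'X - 2%:P) eta ->
  eta ^+ 3 + eta ^+ 2 + eta = 2 /\ 0 < eta < 1.
Proof.
rewrite /root !hornerE => /eqP e.
have etaE : eta ^+ 3 + eta ^+ 2 + eta = 2 by lra.
split=> //; apply/andP; split; rewrite ltNge; apply/negP => h.
  have pos : 0 <= eta ^+ 2 + eta + 1 by have := sqr_ge0 (eta + 2^-1); lra.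
  by have := mulr_ge0_le0 pos h; lra.
have h1 : 1 <= eta ^+ 2 by rewrite exprn_ege1.
have h2 : 1 <= eta ^+ 3 by rewrite exprn_ege1.
lra.
Qed.

Theorem corollary5p4 (R : realType) (eta : R)
    (heta : root ('X^3 + 'X^2 + 'X - 2%:P) eta)
    (A : finGroupType) (hA : (3 <= #|{: A}|)%N)
    (SA : {set A}) (hgen : forall s : A, s \in <<SA>>%g)
    (hsym : forall s : A, s \in SA -> (s^-1)%g \in SA)
    (hid : (1%g : A) \notin SA) :
  let alpha : R := ln 2 / ln (2 / eta) in
  let S := grig_wreath_gens SA in
  exists t : rooted_tree (grig_wreath A),
    [/\ rooted_subtree_of t (cayley S) 1%g,
        spherically_symmetric t,
        IBN t R = lower_growth_exponent R S &
        lower_growth_exponent R S = alpha%:E].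
Proof.
move=> alpha S; have [etaE eta01] := eta_root heta; have /andP[eta0 eta1] := eta01.
have lam2 : 2 <= 2 / eta by rewrite ler_pdivlMr// ger_pMr// ltW.
have [s1 [s2 [s1S s2S s12]]] := generators_pair hA hgen hsym.
have [q [w [q0 q_sep qw w_size]]] := lamp_path.
have qw1 i := let: And3 h _ _ := qw i in h.
have qw2 i := let: And3 _ h _ := qw i in h.
have qw3 i := let: And3 _ _ h := qw i in h.
pose t := lamp_tree s1S s2S s12 hid q0 q_sep qw1 qw3.
pose br := lamp_step w.
have [Q QP] := ball_card_le SA eta01 etaE.
have finB n : finite_set (cayley_ball S n).
  have [k kn] : exists k, n%:R <= (2 / eta) ^+ k.
    have [|k /andP[_ nk]] := @expr_scale R (2 / eta) lam2 n.+1%:R; first by rewrite ler1n.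
    by exists k.+1; apply: le_trans nk; rewrite ler_nat.
  by have [] := QP n k kn.
pose b n := #|` fset_set (cayley_ball S n)|.
pose e n := #|` fset_set (sphere (cayley S) 1%g n)|.
have [C C0 bC] := upper_powR lam2 (b := b) (fun n k nk => (QP n k nk).2).
have stop n k : (1 + 2 / eta ^+ 2) * (2 / eta) ^+ k <= n%:R ->
    (2 ^ k <= (branchings br n).+1)%N.
  move=> kn; suff : ((2 ^ k).-1 <= branchings br n)%N by case: (2 ^ k)%N.
  (* Reaching a stop costs one step per lamp besides the segments. *)
  apply: branchings_ge; rewrite -(ler_nat R); apply: le_trans kn.
  rewrite /lamp_stop; under eq_bigr do rewrite -addn1.
  rewrite big_split /= sum1_card card_ord natrD mulrDl addrC lerD//.
    rewrite mul1r; apply: (@le_trans _ _ ((2 ^ k)%N%:R)).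
      by rewrite ler_nat leq_pred.
    by rewrite natrX lerXn2r// nnegrE// (le_trans _ lam2).
  apply: (@le_trans _ _ (2 * (size (subst_word k))%:R)).
    by rewrite -natrM ler_nat w_size.
  by rewrite -mulrA ler_pM2l// size_subst_word_le.
have [c c0 brc] := lower_powR lam2 (br := branchings br) stop.
have labB d : admissible br d -> cayley_ball S (size d) (lamp_label s1 s2 w d).
  by move=> _; exists (size d) => //; exact: lamp_label_products.
have inj : forall d d', admissible br d -> admissible br d' ->
  lamp_label s1 s2 w d = lamp_label s1 s2 w d' -> d = d'.
  exact: (lamp_label_inj s1S s2S s12 hid q0 q_sep qw1 qw3).
have brb n : (2 ^ branchings br n <= b n)%N.
  by apply: (card_level inj) => // d ad <-; exact: labB.
have [del del0 edel] := sphere_powR lam2 C0 c0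
  (fun n K => card_ball_mul finB n K : (b _ <= (e n).+1 ^ K * b n)%N) bC brc brb.
have eC n : (0 < n)%N -> (e n)%:R <= expR (C * n%:R `^ alpha).
  move=> n0; apply: le_trans (bC n n0); rewrite ler_nat; apply: fsubset_leq_card.
  by rewrite -fset_set_sub//; [exact: sphere_sub_ball|exact: finite_sphere].
have growth : lower_growth_exponent R S = alpha%:E.
  apply: (cvg_limn_einf_sup _).1; apply: cvg_EFin; first exact: nearW.
  exact: (exponent_cvg lam2 C0 del0 eC edel).
exists t; split=> //.
- exact: lamp_tree_subgraph.
- exact: coded_spherically_symmetric.
rewrite growth; apply: IBN_eq; first exact: (alpha_gt0 lam2).
  by move=> l la; apply: (cutset_inf_gt0 lam2 _ c0 la brc).
by move=> l l0; apply: (cutset_inf_gt0_le lam2 finB labB bC).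
Qed.
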